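(* Suppose that $\gamma_0,\dots,\gamma_{n-1}$ are the deformed Verblunsky coefficients of an $n\times n$ unitary matrix with distinct eigenvalues $\{e^{i\lambda_k},1\le k\le n\}$, none of which is equal to $1$. Suppose that $x_k,y_k$, $0\le k\le n$, solve the recursion $$x_{k+1}=x_k+v_ky_k,\qquad y_{k+1}=y_k(1+w_k),\qquad w_k=2\Re\frac{\gamma_k}{1-\gamma_k},\quad v_k=-2\Im\frac{\gamma_k}{1-\gamma_k},$$ with $x_0=0$, $y_0=1$, and set $x(t)+iy(t)=x_{\lfloor nt\rfloor}+iy_{\lfloor nt\rfloor}$ for $t\in[0,1]$. Then $y(t)>0$ for $t\in[0,1)$ and $y(1)=0$, and the spectrum of the operator $\mathtt{Dir}(x+iy,\infty,x(1))$ on $[0,1)$ is the set $\{n\lambda_k+2\pi nj:\ 1\le k\le n,\ j\in\mathbb Z\}$.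
   Context: Deformed Verblunsky coefficients: let $V$ be an $n\times n$ unitary matrix with $n$ distinct eigenvalues, with $1$ not an eigenvalue, and fix a unit vector $e$ not orthogonal to any eigenvector. Gram–Schmidt applied to $e,Ve,\dots,V^{n-1}e$ gives the orthogonal basis $\Phi_0(V)e,\dots,\Phi_{n-1}(V)e$ with $\Phi_0=1$ and $\Phi_k$ monic of degree $k$; put $\Phi_n(z)=\det(z-V)$ and $\Phi_k^*(z)=z^k\overline{\Phi_k(1/\bar z)}$. The Verblunsky coefficients $\alpha_k$ are defined by the Szegő recursion $$\begin{pmatrix}\Phi_{k+1}\\\Phi_{k+1}^*\end{pmatrix}=\begin{pmatrix}1&-\bar\alpha_k\\-\alpha_k&1\end{pmatrix}\begin{pmatrix}z&0\\0&1\end{pmatrix}\begin{pmatrix}\Phi_k\\\Phi_k^*\end{pmatrix},\quad 0\le k\le n-1.$$ The deformed Verblunsky coefficients are $\gamma_k=\bar\alpha_k\frac{\Phi_k^*(1)}{\Phi_k(1)}$, $0\le k\le n-1$. Dirac operator: with $J=\begin{pmatrix}0&-1\\1&0\end{pmatrix}$, $\mathtt{Dir}(x+iy,u_0,u_1)$ on $[0,1)$ is $\tau v=R^{-1}Jv'$, $R=\frac1{2y}\begin{pmatrix}1&-x\\-x&x^2+y^2\end{pmatrix}$, on functions $v:[0,1)\to\mathbb R^2$, where boundary points $u_0,u_1\in\mathbb R\cup\{\infty\}$ are identified with directions of vectors via $(a,b)^t\leftrightarrow a/b$ (so $\infty\leftrightarrow(1,0)^t$, $x(1)\leftrightarrow(x(1),1)^t$).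 Here $\|R\|$ is integrable (limit circle case), and $\tau$ is self-adjoint in the Hilbert space $L^2_R$ with $\langle v,w\rangle_R=\int_0^1v^tRw\,dt$ on the domain of locally absolutely continuous $v\in L^2_R$ with $\tau v\in L^2_R$, $v(0)^tJu_0=0$, $\lim_{s\to1}v(s)^tJu_1=0$. The spectrum is that of the complexified operator. *)

(* Defs.v *)
From mathcomp Require Import all_boot all_order all_algebra.
From mathcomp Require Import sesquilinear spectral.
From mathcomp Require Import complex.
From mathcomp Require Import all_classical all_reals all_analysis.

Set Implicit Arguments.
Unset Strict Implicit.
Unset Printing Implicit Defensive.

Import Order.TTheory GRing.Theory Num.Theory.
Import numFieldNormedType.Exports.

Local Open Scope classical_set_scope.
Local Open Scope ring_scope.
Local Open Scope sesquilinear_scope.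

Definition cis (R : realType) (a : R) : R[i] := (cos a +i* sin a)%C.

Definition hdot (C : numClosedFieldType) (n : nat) (u v : 'cV[C]_n) : C :=
  (v ^t* *m u) 0 0.

(* Column eigenvectors, whereas the library's [eigenspace] consists of row
   vectors. *)
Definition not_orth_eigenvectors (C : numClosedFieldType) (n : nat)
    (V : 'M[C]_n) (e : 'cV[C]_n) : Prop :=
  forall (a : C) (v : 'cV[C]_n), v != 0 -> V *m v = a *: v -> hdot v e != 0.

(* The reversed polynomial z^k * conj (p (1 / conj z)) of a polynomial p of
   degree at most k; see [szego_dualE]. *)
Definition szego_dual (C : numClosedFieldType) (k : nat) (p : {poly C}) :
    {poly C} :=
  \poly_(i < k.+1) (p`_(k - i))^*.

Lemma szego_dualE (C : numClosedFieldType) (k : nat) (p : {poly C}) (z : C) :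
  (size p <= k.+1)%N -> z != 0 ->
  (szego_dual k p).[z] = z ^+ k * (p.[(z^*)^-1])^*.
Proof.
move=> sp z0; rewrite /szego_dual horner_poly (horner_coef_wide _ sp).
rewrite rmorph_sum big_distrr /= (reindex_inj rev_ord_inj) /=.
apply: eq_bigr => i _; have ik : (i <= k)%N by rewrite -ltnS.
rewrite subSS subKn // rmorphM rmorphXn /= fmorphV /= (conjCK z) mulrCA.
by rewrite exprVn -expfB_cond ?(negPf z0).
Qed.

(* The matrix has size n.+1, so that [Phi k] with k <= n are the monic
   orthogonal polynomials and the last one, [Phi n.+1], is det (z - V). *)
Definition orthogonal_polys (C : numClosedFieldType) (n : nat)
    (V : 'M[C]_n.+1) (e : 'cV[C]_n.+1) (Phi : nat -> {poly C}) : Prop :=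
  [/\ Phi 0%N = 1,
      forall k, (k <= n)%N -> Phi k \is monic /\ size (Phi k) = k.+1,
      forall j k, (j < k <= n)%N ->
        hdot (horner_mx V (Phi k) *m e) (horner_mx V (Phi j) *m e) = 0
    & Phi n.+1 = char_poly V].

Definition szego_recursion (C : numClosedFieldType) (n : nat)
    (Phi : nat -> {poly C}) (alpha : nat -> C) : Prop :=
  forall k, (k < n)%N ->
    Phi k.+1 = 'X * Phi k - ((alpha k)^*)%:P * szego_dual k (Phi k)
    /\ szego_dual k.+1 (Phi k.+1) =
       - (alpha k)%:P * ('X * Phi k) + szego_dual k (Phi k).

Definition deformed_verblunsky (C : numClosedFieldType) (n : nat)
    (V : 'M[C]_n.+1) (e : 'cV[C]_n.+1) (gamma : nat -> C) : Prop :=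
  exists (Phi : nat -> {poly C}) (alpha : nat -> C),
    [/\ orthogonal_polys V e Phi, szego_recursion n.+1 Phi alpha
      & forall k, (k < n.+1)%N ->
          gamma k = (alpha k)^* * ((szego_dual k (Phi k)).[1] / (Phi k).[1])].

Section Dirac.
Context (R : realType).
Implicit Types (x y : R -> R) (u : option R).
Implicit Types (v g : R -> 'cV[R]_2) (w h k : R -> 'cV[R[i]]_2).

Definition cv2 (a b : R) : 'cV[R]_2 := \col_i (if i == 0 then a else b).

Definition mx2 (a b c d : R) : 'M[R]_2 :=
  \matrix_(i, j) (if i == 0 then (if j == 0 then a else b)
                  else (if j == 0 then c else d)).

Definition Jmx : 'M[R]_2 := mx2 0 (-1) 1 0.

(* The weight matrix, called R in R^{-1} J v' and in L^2_R. *)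
Definition weight x y (t : R) : 'M[R]_2 :=
  (2 * y t)^-1 *: mx2 1 (- x t) (- x t) (x t ^+ 2 + y t ^+ 2).

(* Boundary points live in R together with infinity, encoded as [None]. *)
Definition bdir (u : option R) : 'cV[R]_2 :=
  if u is Some a then cv2 a 1 else cv2 1 0.

Definition abs_cont_on (F : R -> R) (a b : R) : Prop :=
  forall eps : R, 0 < eps -> exists2 delta : R, 0 < delta &
    forall (m : nat) (l r : 'I_m -> R),
      (forall i, [/\ a <= l i, l i <= r i & r i <= b]) ->
      trivIset setT (fun i => [set` `]l i, r i[]) ->
      \sum_(i < m) (r i - l i) < delta ->
      \sum_(i < m) `|F (r i) - F (l i)| < eps.

(* Functions on [0, 1) are represented by functions on R, of which only the
   values on [0, 1) are ever used; elements of L^2_R are such functions up to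
   almost everywhere equality on [0, 1). *)
Definition loc_abs_cont v : Prop :=
  forall a b : R, 0 <= a -> b < 1 ->
    forall i : 'I_2, abs_cont_on (fun t => v t i 0) a b.

Definition sqnorm x y v : \bar R :=
  (\int[lebesgue_measure]_(t in `[0%R, 1%R[)
     (((v t)^T *m weight x y t *m v t) 0 0)%:E)%E.

Definition in_L2 x y v : Prop :=
  (forall i : 'I_2, measurable_fun `[(0 : R), 1[ (fun t : R => v t i 0 : R)) /\
  (sqnorm x y v < +oo)%E.

Definition ae_eq01 (A : Type) (p q : R -> A) : Prop :=
  {ae lebesgue_measure, forall t : R, 0 <= t < 1 -> p t = q t}.

(* [dirac_tau x y v g]: at almost every point of [0, 1), v is differentiable
   (automatic for a locally absolutely continuous v) and g = R^{-1} J v'. *)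
Definition dirac_tau x y v g : Prop :=
  {ae lebesgue_measure, forall t : R, 0 <= t < 1 ->
    exists2 dv : 'cV[R]_2,
      (forall i : 'I_2, is_derive t (1 : R) (fun s => v s i 0) (dv i 0)) &
      g t = invmx (weight x y t) *m (Jmx *m dv)}.

(* Graph of the real operator Dir(x + iy, u0, u1): v is in its domain and is
   mapped to (the class of) g. *)
Definition Dir x y u0 u1 v g : Prop :=
  [/\ loc_abs_cont v /\ dirac_tau x y v g,
      in_L2 x y v, in_L2 x y g,
      ((v 0)^T *m Jmx *m bdir u0) 0 0 = 0
    & ((v s)^T *m Jmx *m bdir u1) 0 0 @[s --> (1 : R)^'-] --> (0 : R)].

Definition re_part w : R -> 'cV[R]_2 := fun t => map_mx (@complex.Re R) (w t).
Definition im_part w : R -> 'cV[R]_2 := fun t => map_mx (@complex.Im R) (w t).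

Definition DirC x y u0 u1 w h : Prop :=
  Dir x y u0 u1 (re_part w) (re_part h) /\
  Dir x y u0 u1 (im_part w) (im_part h).

Definition in_L2C x y w : Prop := in_L2 x y (re_part w) /\ in_L2 x y (im_part w).

Definition sqnormC x y w : \bar R :=
  (sqnorm x y (re_part w) + sqnorm x y (im_part w))%E.

(* [DirC_shift x y u0 u1 z w k]: w is in the domain and k = (Dir - z) w
   in the complex Hilbert space. *)
Definition DirC_shift x y u0 u1 (z : R[i]) w k : Prop :=
  in_L2C x y k /\
  exists2 h, DirC x y u0 u1 w h & ae_eq01 k (fun t => h t - z *: w t).

Definition in_resolvent_set x y u0 u1 (z : R[i]) : Prop :=
  [/\ forall w, DirC_shift x y u0 u1 z w (fun=> 0) -> ae_eq01 w (fun=> 0),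
      forall k, in_L2C x y k -> exists w, DirC_shift x y u0 u1 z w k
    & exists2 M : R, 0 <= M &
        forall w k, DirC_shift x y u0 u1 z w k ->
          (sqnormC x y w <= M%:E * sqnormC x y k)%E].

Definition Dir_spectrum x y u0 u1 : set R[i] :=
  [set z | ~ in_resolvent_set x y u0 u1 z].

End Dirac.

Definition step_path (R : realType) (n : nat) (xs : nat -> R) (t : R) : R :=
  xs (Num.truncn (n%:R * t)).

(* Main.v *)
(* Write p_k = x_k + i y_k, W_k for the weight on the k-th step and N = n + 1.
   On a step, solutions of tau v = z v are v(t) = exp(- z t J W_k) v(0), and
   v |-> v^T J (p_k, 1)^T, v |-> v^T J (conj p_k, 1)^T are multiplied by
   exp(+- i z t / 2).  The recursion for x and y says
   (p_{k+1}, 1) = ((p_k, 1) - gamma_k (conj p_k, 1)) / (1 - gamma_k), so along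
   the solution starting from (1, 0) these two functionals satisfy, up to a
   common phase, the Szego recursion for Phi_k(zeta) / Phi_k(1) and
   Phi_k^*(zeta) / Phi_k^*(1) with zeta = exp(i z / N).  As y_N = 0, the boundary
   condition at 1 therefore holds iff Phi_N(zeta) = det(zeta - V) = 0.

   If it holds, z is an eigenvalue.  If it fails, the solution phi adapted to 0
   and the solution chi adapted to 1 have a nonzero constant Wronskian, and w is
   recovered from w^T J phi and w^T J chi, whose derivatives are - k^T W phi and
   - k^T W chi when (tau - z) w = k: this gives injectivity, the bound on the
   resolvent and, through Green's function, surjectivity.

   Finally ||Phi_{k+1}(V) e||^2 = (1 - |alpha_k|^2) ||Phi_k(V) e||^2 gives
   |alpha_k| < 1 for k < n and |alpha_n| = 1, whence the signs of y_k. *)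

Require Import Defs.
From mathcomp Require Import all_boot all_order all_algebra.
From mathcomp Require Import sesquilinear spectral.
From mathcomp Require Import complex.
From mathcomp Require Import all_classical all_reals all_analysis.
From mathcomp Require Import measurable_realfun.
From mathcomp Require Import ring lra.

Import Order.TTheory GRing.Theory Num.Theory.
Import numFieldNormedType.Exports.
Local Open Scope classical_set_scope.
Local Open Scope ring_scope.

Set Implicit Arguments.
Unset Strict Implicit.
Unset Printing Implicit Defensive.

(** * Absolutely continuous functions *)

(** The domain of the operator consists of locally absolutely continuous functions, and the equation
    is known only almost everywhere. Uniqueness therefore rests on one fact of real analysis: an
    absolutely continuous function whose derivative vanishes almost everywhere is constant. It is
    derived here from the epsilon-delta definition. On [0, 1) the weight takes finitely many values,
    all with [y_k > 0] and determinant 1/4. It is thus bounded above and below, L^2_R is the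
    ordinary L^2, and solutions extend to the closed interval. The degeneration [y_N = 0] is felt
    only at the endpoint, where [p_N] becomes real and turns into the boundary vector. The delicate
    point in the resolvent is the condition at 1: it is a limit, while an element of the domain is
    not known beforehand to be bounded near 1. A crude bound comes first, only to make the limit
    usable, and the bound that depends on the right-hand side alone comes second. *)

Lemma gauge_induction (R : realType) (a b : R) (Q : R -> Prop) : a <= b -> Q a ->
  (forall s, a <= s <= b -> exists2 rho, 0 < rho &
     forall c d, a <= c <= s -> s <= d <= b -> s - rho < c -> d < s + rho ->
       Q c -> Q d) ->
  Q b.
Proof.
move=> ab Qa step.
pose S := [set c | a <= c <= b /\ Q c].
have Sa : S a by split=> //; rewrite lexx ab.
have hS : has_sup S.
  by split; [exists a | exists b => c [/andP[]]].
have as_ : a <= sup S by apply: ub_le_sup => //; case: hS.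
have sb : sup S <= b by apply: ge_sup; [exists a | move=> c [/andP[]]].
(* The step taken at the supremum itself starts from a point of [S] within [rho] below it. *)
have [|rho rho0 H] := step (sup S); first by rewrite as_ sb.
have [c [/andP[ac cb] Qc] sc] := sup_adherent rho0 hS.
have cs : c <= sup S by apply: ub_le_sup; [case: hS | split=> //; rewrite ac cb].
(* Unless cut off at [b], this point exceeds the supremum and still satisfies [Q]. *)
pose d := Num.min b (sup S + rho / 2).
have Qd : Q d.
  apply: (H c) => //; first by rewrite ac cs.
    rewrite /d ge_min lexx andbT le_min sb /= lerDl.
    by rewrite divr_ge0 ?ltW.
  by rewrite /d gt_min ltrD2l ltr_pdivrMr// ltr_pMr// ltr1n orbT.
have dS : d <= sup S.
  apply: ub_le_sup; first by case: hS.
  split=> //; rewrite /d ge_min lexx /= andbT le_min ab /=.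
  by rewrite (le_trans as_)// lerDl divr_ge0 ?ltW.
suff -> : b = d by [].
apply/eqP; rewrite eq_le; apply/andP; split; last by rewrite /d ge_min lexx.
move: dS; rewrite {1}/d ge_min => /orP[bs|].
  by rewrite /d le_min lexx /= (le_trans bs)// lerDl divr_ge0 ?ltW.
by rewrite gerDl leNgt divr_gt0.
Qed.

Lemma abs_cont_on_sub (R : realType) (F : R -> R) (a b c d : R) :
  a <= c -> d <= b -> abs_cont_on F a b -> abs_cont_on F c d.
Proof.
move=> ac db acF e e0; have [del del0 H] := acF e e0; exists del => // m l r lr.
by apply: H => i; have [cl lri rd] := lr i; split=> //; [exact: le_trans ac _|exact: le_trans rd _].
Qed.

Lemma trivIset_ordered (R : realType) (m : nat) (l r : nat -> R) :
  (forall i j, (i < j < m)%N -> r i <= l j) ->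
  trivIset setT (fun i : 'I_m => [set` `]l i, r i[]).
Proof.
move=> H i j _ _ [z []] /=; rewrite !in_itv/= => /andP[li ri] /andP[lj rj].
apply/val_inj; case: (ltngtP i j) => // ij.
- have zj : z < l j by apply: lt_le_trans ri _; apply: H; rewrite ij ltn_ord.
  by have := lt_trans zj lj; rewrite ltxx.
- have zi : z < l i by apply: lt_le_trans rj _; apply: H; rewrite ij ltn_ord.
  by have := lt_trans zi li; rewrite ltxx.
Qed.

Lemma is_derive_gauge (R : realType) (F : R -> R) (s eps : R) : 0 < eps ->
  is_derive s (1 : R) F 0 ->
  exists2 rho, 0 < rho & forall t, `|t - s| < rho -> `|F t - F s| <= eps * `|t - s|.
Proof.
move=> eps0 /is_derive1_caratheodory [g [Fg gs g0]].
have /cvgrPdist_lt /(_ _ eps0) := gs; rewrite g0 => /nbhs_ballP [rho /= rho0 H].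
exists rho => // t ts; rewrite Fg normrM ler_wpM2r//.
have := H t; rewrite /ball /= distrC => /(_ ts).
by rewrite sub0r normrN => /ltW.
Qed.

Lemma negligible_open_cover (R : realType) (A : set R) (del : R) : 0 < del ->
  (@lebesgue_measure R).-negligible A ->
  exists U : set R, [/\ open U, A `<=` U & (lebesgue_measure U < del%:E)%E].
Proof.
move=> del0 [B [mB B0 AB]].
have [|U [oU BU UB]] := lebesgue_regularity_outer mB _ del0;
  first by rewrite [X in (X < _)%E]B0 ltry.
exists U; split=> //; first exact: subset_trans AB BU.
have mU : measurable U by exact: measurable_realfun.open_measurable.
apply: le_lt_trans UB; rewrite -[X in (lebesgue_measure X <= _)%E](setDUK BU).
rewrite setUC; apply: le_trans (measureU2 _ _ _) _ => //; first exact: measurableD.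
by rewrite [X in (_ + X <= _)%E]B0 adde0.
Qed.

(* Cousin's argument: intervals tagged at points where the derivative vanishes
   contribute at most [eps (b - a)], the others lie in an open set of small
   measure and are controlled by absolute continuity. *)
Lemma abs_cont_derive0 (R : realType) (F : R -> R) (a b : R) : a <= b ->
  abs_cont_on F a b ->
  {ae lebesgue_measure, forall t : R, a < t < b -> is_derive t (1 : R) F 0} ->
  F b = F a.
Proof.
move=> ab acF aeF; apply/eqP; rewrite -subr_eq0 -normr_le0.
apply/ler_addgt0Pr => eps eps0; rewrite add0r.
(* The summand 1 keeps the divisor positive when [a = b]. *)
have e1 : 0 < eps / 2 / (b - a + 1).
  by rewrite !divr_gt0// ltr_wpDl// subr_ge0.
have e2 : 0 < eps / 2 by rewrite divr_gt0.
set ep := eps / 2 / (b - a + 1) in e1.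
have [del del0 Hdel] := acF _ e2.
(* The endpoints are counted as exceptional because the derivative is given only in the open
   interval. *)
pose E := ~` [set t | a < t < b -> is_derive t (1 : R) F 0] `|` [set a; b].
have NE : (@lebesgue_measure R).-negligible E.
  apply: negligibleU; first exact: aeF.
  by apply: negligibleU; apply/negligibleP => //; exact: lebesgue_measure_set1.
have [U [oU EU Udel]] := negligible_open_cover del0 NE.
have mU : measurable U by exact: measurable_realfun.open_measurable.
(* The state reached at [c]: the intervals with exceptional tags met so far. Comparing their total
   length with the measure of [U] inside []a, c]] is a bound that survives appending one more
   interval contained in [U]. *)
pose Q c := exists m (l r : nat -> R),
  [/\ forall i, (i < m)%N -> [/\ a <= l i, l i <= r i & r i <= c],
      forall i j, (i < j < m)%N -> r i <= l j,
      ((\sum_(i < m) (r i - l i))%:E <= lebesgue_measure (U `&` `]a, c]))%E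
    & `|F c - F a| <= ep * (c - a) + \sum_(i < m) `|F (r i) - F (l i)|].
suff [m [l [r [lr lro muU Fba]]]] : Q b.
  apply: le_trans Fba _; rewrite [leRHS](splitr eps) lerD//.
    rewrite /ep mulrAC -mulrA ger_pMr// ler_pdivrMr; last by rewrite ltr_wpDl// subr_ge0.
    by rewrite mul1r lerDl.
  apply/ltW/(Hdel m (fun i => l i) (fun i => r i)).
  - by move=> i; exact: lr.
  - exact: trivIset_ordered.
  - rewrite -lte_fin (le_lt_trans muU)// (le_lt_trans _ Udel)//.
    by apply: le_measure; rewrite ?inE//; exact: measurableI.
apply: (gauge_induction (a := a) (b := b)) => //.
  exists 0%N, (fun=> 0), (fun=> 0); split=> //.
  - by rewrite big_ord0 measure_ge0.
  - by rewrite big_ord0 !subrr normr0 mulr0 addr0.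

move=> s /andP[as_ sb].
have [sE|nE] := pselect (E s).
  have /EU := sE => Us.
  have /nbhs_ballP[rho /= rho0 sU] : nbhs s U by exact: open_nbhs_nbhs.
  exists rho => // c d /andP[ac cs] /andP[sd db] sc ds [m [l [r [lr lro muU Fca]]]].
  have cd : c <= d by exact: le_trans cs sd.
  (* The tag is exceptional: [[c, d]] lies in [U] by the choice of [rho] and becomes the last
     recorded interval. *)
  exists m.+1, (fun i => if (i < m)%N then l i else c),
    (fun i => if (i < m)%N then r i else d); split.
  - move=> i _; case: ifP => [im|_]; last by split.
    by have [? ? ric] := lr _ im; split=> //; exact: le_trans cd.
  - move=> i j /andP[ij]; rewrite ltnS => jm.
    rewrite (leq_trans ij jm); case: ifP => [jm'|_]; first by apply: lro; rewrite ij.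
    by have [] := lr i (leq_trans ij jm).
  - rewrite big_ord_recr /= ltnn.
    under eq_bigr do rewrite ltn_ord.
    have -> : U `&` `]a, d] = (U `&` `]a, c]) `|` `]c, d].
      rewrite (@itv_bndbnd_setU _ _ (BRight a) (BRight c)) ?bnd_simp// setIUr.
      congr (_ `|` _); apply/setIidPr => t /=; rewrite in_itv/= => /andP[ct td].
      apply: sU; rewrite /ball/= ltr_distlC.
      by rewrite (lt_trans sc ct) (le_lt_trans td ds).
    rewrite measureU//; first last.
    - apply/seteqP; split=> // t /= [[_]]; rewrite !in_itv/= => /andP[_ tc] /andP[ct _].
      by have := le_lt_trans tc ct; rewrite ltxx.
    - exact: measurableI.
    rewrite EFinD leeD//.
    have [cd'|dc] := ltP c d; first by rewrite /= lebesgue_measure_itv /= lte_fin cd' EFinB.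
    by rewrite (le_trans _ (measure_ge0 _ _))// lee_fin subr_le0.
  - rewrite big_ord_recr /= ltnn.
    under eq_bigr do rewrite ltn_ord.
    rewrite -(subrKA (F c)) (le_trans (ler_normD _ _))//.
    rewrite addrA [leLHS]addrC lerD2r (le_trans Fca)// lerD2r ler_wpM2l ?(ltW e1)//.
    by rewrite lerD2r.
have [dF sa sb'] : [/\ is_derive s (1 : R) F 0, s != a & s != b].
  split.
  - apply: contrapT => H; apply: (nE); left => /= H'; apply: H; apply: H'.
    rewrite !lt_neqAle as_ sb !andbT; apply/andP; split.
      by apply/negP => /eqP H'; apply: (nE); right; left.
    by apply/negP => /eqP H'; apply: (nE); right; right.
  - by apply/eqP => H'; apply: (nE); right; left.
  - by apply/eqP => H'; apply: (nE); right; right.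
have [rho rho0 H] := is_derive_gauge e1 dF.
exists rho => // c d /andP[ac cs] /andP[sd db] sc ds [m [l [r [lr lro muU Fca]]]].
have cd : c <= d by exact: le_trans cs sd.
exists m, l, r; split=> //.
- by move=> i /lr[? ? ?]; split=> //; exact: le_trans cd.
- rewrite (le_trans muU)//; apply: le_measure; rewrite ?inE//; try exact: measurableI.
  by apply: setIS; apply: subset_itvl; rewrite bnd_simp.
(* The derivative compares values with [F s] only, so [[c, d]] is split at its tag [s]. *)
- have Hc : `|F s - F c| <= ep * (s - c).
    rewrite distrC (le_trans (H _ _))//.
      by rewrite ltr_distl sc (le_lt_trans cs)// ltrDl.
    by rewrite distrC ger0_norm// subr_ge0.
  have Hd : `|F d - F s| <= ep * (d - s).
    rewrite (le_trans (H _ _))//.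
      by rewrite ltr_distl ds andbT (lt_le_trans _ sd)// ltrBlDr ltrDl.
    by rewrite ger0_norm// subr_ge0.
  rewrite -(subrKA (F c)) (le_trans (ler_normD _ _))//.
  rewrite -(subrKA (F s)) (le_trans (lerD (ler_normD _ _) (lexx _)))//.
  apply: le_trans (lerD (lerD Hd Hc) Fca) _; rewrite addrA lerD2r -!mulrDr.
  by rewrite ler_wpM2l ?(ltW e1)//; lra.
Qed.

(** * Stability and first consequences of absolute continuity *)

Section abs_cont_closure.
Context (R : realType).
Implicit Types (F G : R -> R) (a b : R).

Lemma abs_cont_on_lipschitz F a b K :
  (forall s t, a <= s -> s <= t -> t <= b -> `|F t - F s| <= K * (t - s)) ->
  abs_cont_on F a b.
Proof.
move=> lipF e e0; have K0 : 0 < `|K| + 1 by rewrite ltr_wpDl.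
exists (e / (`|K| + 1)); first by rewrite divr_gt0.
move=> m l r lr _; rewrite ltr_pdivlMr// => sume.
apply: le_lt_trans sume; rewrite mulr_suml; apply: ler_sum => i _.
have [al lri rb] := lr i; apply: le_trans (lipF _ _ al lri rb) _.
rewrite mulrC ler_wpM2l ?subr_ge0//.
by rewrite (le_trans (ler_norm K))// lerDl.
Qed.

Lemma abs_cont_onD F G a b : abs_cont_on F a b -> abs_cont_on G a b ->
  abs_cont_on (fun t => F t + G t) a b.
Proof.
move=> acF acG e e0; have e2 : 0 < e / 2 by rewrite divr_gt0.
have [d1 d10 H1] := acF _ e2; have [d2 d20 H2] := acG _ e2.
exists (Num.min d1 d2); first by rewrite lt_min d10.
move=> m l r lr tI; rewrite lt_min => /andP[s1 s2].
rewrite (splitr e); apply: le_lt_trans (ltrD (H1 _ _ _ lr tI s1) (H2 _ _ _ lr tI s2)).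
rewrite -big_split /=; apply: ler_sum => i _.
by rewrite opprD addrACA ler_normD.
Qed.

Lemma abs_cont_onM F G a b K : abs_cont_on F a b -> abs_cont_on G a b ->
  (forall t, a <= t <= b -> `|F t| <= K) ->
  (forall t, a <= t <= b -> `|G t| <= K) ->
  abs_cont_on (fun t => F t * G t) a b.
Proof.
move=> acF acG bF bG e e0; have K0 : 0 < `|K| + 1 by rewrite ltr_wpDl.
have e2 : 0 < e / 2 / (`|K| + 1) by rewrite !divr_gt0.
have [d1 d10 H1] := acF _ e2; have [d2 d20 H2] := acG _ e2.
exists (Num.min d1 d2); first by rewrite lt_min d10.
move=> m l r lr tI; rewrite lt_min => /andP[s1 s2].
have := ltrD (H1 _ _ _ lr tI s1) (H2 _ _ _ lr tI s2).
rewrite -mulrDl -splitr ltr_pdivlMr//; apply: le_lt_trans.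
rewrite -big_split /= mulr_suml; apply: ler_sum => i _.
have [al lri rb] := lr i.
have -> : F (r i) * G (r i) - F (l i) * G (l i) =
  (F (r i) - F (l i)) * G (r i) + F (l i) * (G (r i) - G (l i)) by ring.
rewrite (le_trans (ler_normD _ _))// [leRHS]mulrDl !normrM lerD//.
  rewrite ler_wpM2l// (le_trans (bG _ _)) ?(le_trans al lri)//.
  by rewrite (le_trans (ler_norm K))// lerDl.
rewrite mulrC ler_wpM2l// (le_trans (bF _ _)) ?al ?(le_trans lri)//.
by rewrite (le_trans (ler_norm K))// lerDl.
Qed.

Lemma abs_cont_on_cst (c a b : R) : abs_cont_on (fun=> c) a b.
Proof.
by apply: (@abs_cont_on_lipschitz _ _ _ 0) => s t *; rewrite subrr normr0 mul0r.
Qed.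

Lemma abs_cont_on_eq F G a b : (forall t, a <= t <= b -> F t = G t) ->
  abs_cont_on F a b -> abs_cont_on G a b.
Proof.
move=> FG acF e e0; have [d d0 H] := acF e e0; exists d => // m l r lr tI s.
have := H m l r lr tI s; congr (_ < _); apply: eq_bigr => i _.
have [al lri rb] := lr i.
by rewrite !FG ?al ?rb ?(le_trans al lri) ?(le_trans lri rb).
Qed.

Lemma abs_cont_on_unif F a b e : abs_cont_on F a b -> 0 < e ->
  exists2 d, 0 < d & forall s t, a <= s <= b -> a <= t <= b -> `|s - t| < d ->
    `|F s - F t| < e.
Proof.
move=> acF e0; have [d d0 H] := acF e e0; exists d => // s t.
wlog st : s t / t <= s.
  by move=> W; case: (leP t s) => [/W //|/ltW /W H' hs ht];
    rewrite distrC (distrC (F _)) => /H'; exact.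
move=> /andP[as_ sb] /andP[at_ tb]; rewrite ger0_norm ?subr_ge0// => std.
have := H 1%N (fun=> t) (fun=> s); rewrite !big_ord1; apply=> //.
by move=> i j _ _ _; rewrite !ord1.
Qed.

Lemma abs_cont_on_bounded F a b : a <= b -> abs_cont_on F a b ->
  exists K, forall t, a <= t <= b -> `|F t| <= K.
Proof.
move=> ab acF; have [d d0 H] := abs_cont_on_unif acF ltr01.
apply: (gauge_induction (Q := fun c => exists K, forall t, a <= t <= c -> `|F t| <= K) ab).
  by exists `|F a| => t; rewrite -eq_le => /eqP <-.
move=> s /andP[as_ sb]; exists d => // c e /andP[ac cs] /andP[se eb] sc es [K HK].
exists (Num.max K (`|F s| + 1)) => t /andP[at_ te].
have [tc|ct] := leP t c; first by rewrite le_max HK ?at_.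
rewrite le_max; apply/orP; right.
rewrite -lerBlDl (le_trans (lerB_dist _ _))// ltW// H//.
- by rewrite at_ (le_trans te).
- by rewrite as_.
- by rewrite ltr_distl (lt_trans sc ct) (le_lt_trans te).
Qed.

Lemma abs_cont_on_continuous F a b : abs_cont_on F a b ->
  {within `[a, b], continuous F}.
Proof.
move=> acF; apply/subspace_continuousP => x /=; rewrite in_itv/= => xab.
apply/cvgrPdist_lt => e e0; have [d d0 H] := abs_cont_on_unif acF e0.
rewrite near_withinE; apply/nbhs_ballP; exists d => //= t xt.
by rewrite in_itv/= => tab; exact: H.
Qed.

Lemma abs_cont_on_measurable F a b : abs_cont_on F a b ->
  measurable_fun `[a, b] F.
Proof.
move=> acF; apply: measurable_realfun.subspace_continuous_measurable_fun => //.
exact: abs_cont_on_continuous.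
Qed.

End abs_cont_closure.

(** * Indefinite integrals *)

Section primitive.
Context (R : realType).
Notation mu := (@lebesgue_measure R).
Variable f : R -> R.
Hypothesis intf : mu.-integrable `[(0 : R), 1[ (EFin \o f).

(** Extended by zero, the integrand is integrable on the whole line, so that its primitive is
    defined and absolutely continuous up to the endpoint 1, where [f] itself is not controlled. *)
Let f1 := f \_ `[(0 : R), 1[.

Let intf1 : mu.-integrable setT (EFin \o f1).
Proof. by have := intf; rewrite integrable_mkcond//= (restrict_EFin f). Qed.

Let intf1S (A : set R) : measurable A -> mu.-integrable A (EFin \o f1).
Proof. by move=> mA; apply: integrableS intf1. Qed.

Definition primitive (t : R) : R := \int[mu]_(s in `[0, t]) f1 s.

Let primitiveB (s t : R) : 0 <= s -> s <= t ->
  primitive t - primitive s = \int[mu]_(u in `]s, t[) f1 u.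
Proof.
move=> s0 st; rewrite /primitive Rintegral_itvB ?bnd_simp//; last exact: intf1S.
by rewrite -Rintegral_itv_bndo_bndc//; exact: intf1S.
Qed.

Lemma primitive0 : primitive 0 = 0.
Proof. by rewrite /primitive set_itv1 Rintegral_set1. Qed.

Lemma primitive_abs_cont (b : R) : abs_cont_on primitive 0 b.
Proof.
move=> e e0; have [d [d0 H]] := integral_normr_continuous intf1 e0.
exists d => // m l r lr tI sumd.
(* The increments of the primitive add up to at most the integral of [|f1|] over this union, which
   is small because its measure is. *)
pose U := \big[setU/set0]_(i < m) [set` `]l i, r i[].
have mU : measurable U by apply: bigsetU_measurable.
have muU : (mu U < d%:E)%E.
  rewrite measure_bigsetU_ord//.
  apply: (@le_lt_trans _ _ (\sum_(i < m) (r i - l i))%:E); last by rewrite lte_fin.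
  rewrite -sumEFin; apply: lee_sum => i _.
  rewrite [X in (X <= _)%E](_ : _ = (if (l i < r i)%R then (r i - l i)%:E else 0)%E); last first.
    by rewrite -[LHS]/(mu _) lebesgue_measure_itv /= lte_fin.
  case: ifP => [//|/negbT].
  by have [_ lri _] := lr i; rewrite lee_fin subr_ge0.
apply: le_lt_trans (H _ mU muU).
rewrite -lee_fin /Rintegral fineK; last first.
  apply: integrable_fin_num => //.
  exact/(integrable_norm (intf1S _)).
rewrite ge0_integral_bigsetU//=.
- rewrite -sumEFin; apply: lee_sum => i _; have [l0 lri rb] := lr i.
  rewrite primitiveB// EFin_normr_Rintegral//; last exact: intf1S.
  apply: le_abse_integral => //.
  exact: measurable_int (intf1S _).
- exact: index_enum_uniq.
- by apply: sub_trivIset tI.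
- apply/measurable_EFinP/measurableT_comp => //; apply/measurable_EFinP.
  exact: measurable_int (intf1S _).
Qed.

Lemma primitive_derive :
  {ae mu, forall t : R, 0 < t < 1 -> is_derive t (1 : R) primitive (f t)}.
Proof.
have := FTC1 (a := BLeft 0) (fun y => intf1S (measurable_itv _))
  (open_integrable_locally openT intf1).
apply: filterS; first exact: (ae_filter_ringOfSetsType mu).
move=> t H /andP[t0 t1].
have [|dF F'] := H; first by rewrite lte_fin.
apply: DeriveDef => //; rewrite -derive1E F' /f1 patchE mem_set//=.
by rewrite in_itv/= (ltW t0).
Qed.

Lemma primitive_bound (t : R) :
  `|primitive t| <= \int[mu]_(s in `[0, 1[) `|f s|.
Proof.
rewrite (le_trans (le_normr_Rintegral _ (intf1S _)))//.
have -> : \int[mu]_(s in `[0, 1[) `|f s| = \int[mu]_s `|f1 s|.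
  rewrite Rintegral_mkcond; apply: eq_Rintegral => s _.
  by rewrite /f1 restrict_normr.
have fin A : measurable A -> (\int[mu]_(s in A) (`|f1 s|)%:E)%E \is a fin_num.
  by move=> mA; apply: integrable_fin_num => //; exact/(integrable_norm (intf1S _)).
rewrite -lee_fin /Rintegral !fineK ?fin//; apply: ge0_subset_integral => //=.
apply: measurableT_comp => //; apply: measurableT_comp => //.
by have /measurable_int/measurable_EFinP := intf1.
Qed.

End primitive.

(** * Complex-valued functions of a real variable *)

Section complex_calculus.
Context (R : realType).
Local Notation Re := (@complex.Re R).
Local Notation Im := (@complex.Im R).
Implicit Types (f g : R -> R[i]) (t s : R) (z c d : R[i]).

Lemma ReD z c : Re (z + c) = Re z + Re c. Proof. by case: z; case: c. Qed.
Lemma ImD z c : Im (z + c) = Im z + Im c. Proof. by case: z; case: c. Qed.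
Lemma ReM z c : Re (z * c) = Re z * Re c - Im z * Im c.
Proof. by case: z; case: c. Qed.
Lemma ImM z c : Im (z * c) = Re z * Im c + Im z * Re c.
Proof. by case: z; case: c => /= *. Qed.
Lemma complexP z c : Re z = Re c -> Im z = Im c -> z = c.
Proof. by case: z; case: c => /= ? ? ? ? -> ->. Qed.

(** The modulus on [R[i]] takes its values in [R[i]]. This submultiplicative substitute is
    real-valued, and its measurability and integrability reduce to those of the two components. *)
Definition l1norm z : R := `|Re z| + `|Im z|.

Lemma l1norm_ge0 z : 0 <= l1norm z. Proof. exact: addr_ge0. Qed.

Lemma l1normD z c : l1norm (z + c) <= l1norm z + l1norm c.
Proof. by rewrite /l1norm ReD ImD addrACA lerD// ler_normD. Qed.

Lemma l1normN z : l1norm (- z) = l1norm z.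
Proof. by case: z => a b; rewrite /l1norm /= !normrN. Qed.

Lemma l1normB z c : l1norm (z - c) <= l1norm z + l1norm c.
Proof. by rewrite -(l1normN c) l1normD. Qed.

Lemma l1normM z c : l1norm (z * c) <= l1norm z * l1norm c.
Proof.
rewrite /l1norm ReM ImM.
apply: le_trans (lerD (ler_normB _ _) (ler_normD _ _)) _.
rewrite !normrM; lra.
Qed.

Lemma l1norm0 : l1norm 0 = 0. Proof. by rewrite /l1norm normr0 addr0. Qed.

Lemma l1norm_eq0 z : l1norm z <= 0 -> z = 0.
Proof.
move=> H; have /eqP : l1norm z = 0 by apply: le_anti; rewrite H l1norm_ge0.
rewrite paddr_eq0// !normr_eq0 => /andP[/eqP H1 /eqP H2].
exact: complexP.
Qed.

Lemma l1normC (a : R) : l1norm a%:C%C = `|a|.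
Proof. by rewrite /l1norm normr0 addr0. Qed.

Definition cderive f t c :=
  is_derive t (1 : R) (fun s => Re (f s)) (Re c) /\
  is_derive t (1 : R) (fun s => Im (f s)) (Im c).

Lemma cderive_eq f t c d : cderive f t c -> c = d -> cderive f t d.
Proof. by move=> ? <-. Qed.

Lemma cderive_near f g t c :
  (\forall s \near t, f s = g s) -> cderive f t c -> cderive g t c.
Proof.
move=> fg [fR fI]; split.
- by apply: near_eq_is_derive fR; apply: filterS fg => s ->.
- by apply: near_eq_is_derive fI; apply: filterS fg => s ->.
Qed.

Lemma cderive_cst c t : cderive (fun=> c) t 0.
Proof. by split; exact: is_derive_cst. Qed.

Lemma cderiveD f g t c d : cderive f t c -> cderive g t d ->
  cderive (fun s => f s + g s) t (c + d).
Proof.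
move=> [fR fI] [gR gI]; split.
- rewrite (_ : (fun s => _) = (fun s => Re (f s)) \+ (fun s => Re (g s))).
    by rewrite ReD; exact: is_deriveD.
  by apply/funext => s; rewrite ReD.
- rewrite (_ : (fun s => _) = (fun s => Im (f s)) \+ (fun s => Im (g s))).
    by rewrite ImD; exact: is_deriveD.
  by apply/funext => s; rewrite ImD.
Qed.

Lemma cderiveM f g t c d : cderive f t c -> cderive g t d ->
  cderive (fun s => f s * g s) t (c * g t + f t * d).
Proof.
move=> [fR fI] [gR gI]; split.
- rewrite (_ : (fun s => _) = (fun s => Re (f s)) * (fun s => Re (g s))
     - (fun s => Im (f s)) * (fun s => Im (g s))).
    apply: is_derive_eq; rewrite /= ReD !ReM /GRing.scale /=; ring.
  by apply/funext => s; rewrite ReM.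
- rewrite (_ : (fun s => _) = (fun s => Re (f s)) * (fun s => Im (g s))
     + (fun s => Im (f s)) * (fun s => Re (g s))).
    apply: is_derive_eq; rewrite /= ImD !ImM /GRing.scale /=; ring.
  by apply/funext => s; rewrite ImM.
Qed.

Lemma cderiveZ c f t d : cderive f t d -> cderive (fun s => c * f s) t (c * d).
Proof.
move=> fd; apply: cderive_eq (cderiveM (cderive_cst c t) fd) _.
by rewrite mul0r add0r.
Qed.

(** The exponential of [c s] for complex [c] and real [s], written as modulus times phase so that it
    is differentiated through real functions. *)
Definition cexp c s : R[i] := (expR (Re c * s))%:C%C * cis (Im c * s).

Lemma cisD (a b : R) : cis (a + b) = cis a * cis b.
Proof. by apply: complexP; rewrite ?ReM ?ImM /cis /= ?cosD ?sinD //; ring. Qed.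

Lemma cexp0 c : cexp c 0 = 1.
Proof.
by rewrite /cexp !mulr0 expR0 mul1r /cis cos0 sin0.
Qed.

Lemma cexpD c d s : cexp (c + d) s = cexp c s * cexp d s.
Proof.
rewrite /cexp ReD ImD !mulrDl expRD cisD (rmorphM (real_complex R)) /=; ring.
Qed.

Lemma cexpN c s : cexp c s * cexp (- c) s = 1.
Proof. 
rewrite -cexpD subrr /cexp !mul0r expR0 mul1r /cis.
by rewrite cos0 sin0.
Qed.

Lemma cexp_derive c s : cderive (cexp c) s (c * cexp c s).
Proof.
split.
- rewrite (_ : (fun s => _) =
    (fun s => expR (Re c * s)) * (fun s => cos (Im c * s))).
    apply: is_derive_eq; rewrite /cexp /= !(ReM,ImM) /GRing.scale /=; ring.
  by apply/funext => u; rewrite /cexp ReM /= mul0r subr0.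
- rewrite (_ : (fun s => _) =
    (fun s => expR (Re c * s)) * (fun s => sin (Im c * s))).
    apply: is_derive_eq; rewrite /cexp /= !(ReM,ImM) /GRing.scale /=; ring.
  by apply/funext => u; rewrite /cexp ImM /= mul0r addr0.
Qed.

End complex_calculus.

(** * Complex-valued absolutely continuous functions *)

Section complex_abs_cont.
Context (R : realType).
Local Notation Re := (@complex.Re R).
Local Notation Im := (@complex.Im R).
Notation mu := (@lebesgue_measure R).
Implicit Types (f g : R -> R[i]) (a b t s : R) (c z : R[i]).

Definition cabs_cont f a b :=
  abs_cont_on (fun t => Re (f t)) a b /\ abs_cont_on (fun t => Im (f t)) a b.

Lemma cabs_cont_sub f a b a' b' : a <= a' -> b' <= b ->
  cabs_cont f a b -> cabs_cont f a' b'.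
Proof. by move=> aa' bb' [? ?]; split; apply: abs_cont_on_sub aa' bb' _. Qed.

Lemma cabs_cont_cst c a b : cabs_cont (fun=> c) a b.
Proof. by split; exact: abs_cont_on_cst. Qed.

Lemma cabs_contD f g a b : cabs_cont f a b -> cabs_cont g a b ->
  cabs_cont (fun t => f t + g t) a b.
Proof.
move=> [fR fI] [gR gI]; split.
- by apply: abs_cont_on_eq (abs_cont_onD fR gR) => t _; rewrite ReD.
- by apply: abs_cont_on_eq (abs_cont_onD fI gI) => t _; rewrite ImD.
Qed.

Lemma cabs_cont_bounded f a b : a <= b -> cabs_cont f a b ->
  exists K, forall t, a <= t <= b -> l1norm (f t) <= K.
Proof.
move=> ab [/abs_cont_on_bounded -/(_ ab)[K HK] /abs_cont_on_bounded -/(_ ab)[L HL]].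
by exists (K + L) => t tab; apply: lerD; [exact: HK|exact: HL].
Qed.

Lemma normRe_le z : `|Re z| <= l1norm z. Proof. by rewrite lerDl. Qed.
Lemma normIm_le z : `|Im z| <= l1norm z. Proof. by rewrite lerDr. Qed.

Lemma cabs_cont_unif f a b e : cabs_cont f a b -> 0 < e ->
  exists2 d, 0 < d & forall s t, a <= s <= b -> a <= t <= b -> `|s - t| < d ->
    l1norm (f s - f t) < e.
Proof.
move=> [fR fI] e0; have e2 : 0 < e / 2 by rewrite divr_gt0.
have [d1 d10 H1] := abs_cont_on_unif fR e2.
have [d2 d20 H2] := abs_cont_on_unif fI e2.
exists (Num.min d1 d2); first by rewrite lt_min d10.
move=> s t sab tab; rewrite lt_min => /andP[st1 st2].
rewrite (splitr e) /l1norm ReD ImD; have := ltrD (H1 s t sab tab st1) (H2 s t sab tab st2).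
by case: (f t).
Qed.

Lemma cabs_contM f g a b : a <= b -> cabs_cont f a b -> cabs_cont g a b ->
  cabs_cont (fun t => f t * g t) a b.
Proof.
move=> ab acf acg; have [K HK] := cabs_cont_bounded ab acf.
have [L HL] := cabs_cont_bounded ab acg; move: acf acg => [fR fI] [gR gI].
have bnd h M (p : R[i] -> R) : (forall z, `|p z| <= l1norm z) ->
  (forall t, a <= t <= b -> l1norm (h t) <= M) -> M <= Num.max K L ->
  forall t, a <= t <= b -> `|p (h t)| <= Num.max K L.
  by move=> Hp HM ML t /HM Ht; exact: le_trans (Hp _) (le_trans Ht ML).
have HRf := bnd _ _ _ normRe_le HK; have HIf := bnd _ _ _ normIm_le HK.
have HRg := bnd _ _ _ normRe_le HL; have HIg := bnd _ _ _ normIm_le HL.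
have KM : K <= Num.max K L by rewrite le_max lexx.
have LM : L <= Num.max K L by rewrite le_max lexx orbT.
have acM F G := abs_cont_onM (F := F) (G := G) (a := a) (b := b) (K := Num.max K L).
split.
- apply: abs_cont_on_eq (abs_cont_onD (acM _ _ fR gR (HRf KM) (HRg LM))
    (abs_cont_onM (abs_cont_on_cst (-1) a b) (acM _ _ fI gI (HIf KM) (HIg LM))
      (K := Num.max 1 (Num.max K L * Num.max K L)) _ _)) => t tab.
  + by rewrite ReM mulN1r.
  + by rewrite normrN1 le_max lexx.
  + by rewrite normrM le_max ler_pM ?orbT// ?HIf ?HIg.
- apply: abs_cont_on_eq (abs_cont_onD (acM _ _ fR gI (HRf KM) (HIg LM))
    (acM _ _ fI gR (HIf KM) (HRg LM))) => t tab.
  by rewrite ImM.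
Qed.

Lemma cabs_contZ c f a b : a <= b -> cabs_cont f a b ->
  cabs_cont (fun t => c * f t) a b.
Proof. by move=> ab; apply: cabs_contM => //; exact: cabs_cont_cst. Qed.

(** The time spent in [[a, a + d]] up to time [t]. Running the k-th exponential for this time gives
    one formula for the solution on all steps, without case analysis on [t]. *)
Definition clamp a d t : R := Num.min (Num.max (t - a) 0) d.

Lemma clamp_itv a d t : 0 <= d -> 0 <= clamp a d t <= d.
Proof.
by move=> d0; rewrite /clamp le_min le_max lexx orbT d0 ge_min lexx orbT.
Qed.

Lemma clamp_lo a d t : 0 <= d -> t <= a -> clamp a d t = 0.
Proof. by move=> d0 ta; rewrite /clamp max_r ?subr_le0// min_l. Qed.

Lemma clamp_hi a d t : 0 <= d -> a + d <= t -> clamp a d t = d.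
Proof.
move=> d0 ta; rewrite /clamp min_r// le_max lerBrDl ta //.
Qed.

Lemma clamp_mid a d t : a <= t -> t <= a + d -> clamp a d t = t - a.
Proof. by move=> ta td; rewrite /clamp max_l ?subr_ge0// min_l// lerBlDl. Qed.

Lemma clamp_lipschitz a d s t : 0 <= d -> s <= t ->
  0 <= clamp a d t - clamp a d s <= t - s.
Proof.
move=> d0 st; have [ta|at_] := leP t a.
  by rewrite !clamp_lo// ?(le_trans st)// subrr lexx subr_ge0.
have [sa|as_] := leP s a.
  have [ta|/ltW ta] := leP (a + d) t; first by rewrite clamp_hi// clamp_lo//; lra.
  by rewrite (clamp_mid (ltW at_) ta) clamp_lo//; lra.
have [ts|/ltW sd] := leP (a + d) s.
  by rewrite !clamp_hi// ?(le_trans ts)// subrr lexx subr_ge0.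
rewrite (clamp_mid (ltW as_) sd).
have [td|/ltW td] := leP (a + d) t; first by rewrite clamp_hi//; lra.
by rewrite (clamp_mid (ltW at_) td); lra.
Qed.

Lemma cexp_add c s t : cexp c (s + t) = cexp c s * cexp c t.
Proof.
rewrite /cexp !mulrDr expRD cisD (rmorphM (real_complex R)) /=; ring.
Qed.

Lemma cexp_bound c s : 0 <= s <= 1 -> l1norm (cexp c s) <= 2 * expR `|Re c|.
Proof.
move=> /andP[s0 s1]; rewrite (le_trans (l1normM _ _))// l1normC mulrC.
rewrite ler_pM// ?l1norm_ge0//.
  by rewrite /l1norm (natrD _ 1 1) lerD// ler_norml ?cos_geN1 ?cos_le1 ?sin_geN1 ?sin_le1.
rewrite ger0_norm ?expR_ge0// ler_expR (le_trans (ler_norm _))// normrM.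
by rewrite ler_piMr// ger0_norm.
Qed.

Lemma lipschitz_derive (F F' : R -> R) (K s t : R) :
  (forall u, is_derive u (1 : R) F (F' u)) -> s <= t ->
  (forall u, s <= u <= t -> `|F' u| <= K) -> `|F t - F s| <= K * (t - s).
Proof.
move=> dF st bF.
have cF : {within `[s, t], continuous F}.
  by apply: derivable_within_continuous => u _; have [] := dF u.
have [u] := MVT_segment st (fun u _ => dF u) cF.
rewrite in_itv/= => ust ->; rewrite normrM (ger0_norm (_ : 0 <= t - s)) ?subr_ge0//.
by rewrite ler_wpM2r ?subr_ge0// bF.
Qed.

Lemma cexp_clamp_abs_cont c a d a' b' : 0 <= d <= 1 ->
  cabs_cont (fun t => cexp c (clamp a d t)) a' b'.
Proof.
move=> /andP[d0 d1].
have bnd u : 0 <= u <= 1 -> l1norm (c * cexp c u) <= l1norm c * (2 * expR `|Re c|).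
  move=> u01; apply: le_trans (l1normM _ _) _.
  by rewrite ler_wpM2l ?l1norm_ge0// cexp_bound.
have H s t u : clamp a d s <= u <= clamp a d t -> 0 <= u <= 1.
  have := clamp_itv a s d0; have := clamp_itv a t d0.
  move=> /andP[_ td] /andP[s0 _] /andP[su ut].
  by rewrite (le_trans s0 su) (le_trans (le_trans ut td)).
split; apply: (@abs_cont_on_lipschitz _ _ _ _ (l1norm c * (2 * expR `|Re c|))) => s t as_ st tb;
  have /andP[st' st''] := clamp_lipschitz a d0 st.
- apply: le_trans (lipschitz_derive (F := fun s => Re (cexp c s))
    (F' := fun s => Re (c * cexp c s)) (K := l1norm c * (2 * expR `|Re c|)) _ _ _) _.
  + by move=> u; have [] := cexp_derive c u.
  + by rewrite -subr_ge0.
  + by move=> u /H/bnd; apply: le_trans; exact: normRe_le.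
  + by rewrite ler_wpM2l// mulr_ge0 ?l1norm_ge0// mulr_ge0// expR_ge0.
- apply: le_trans (lipschitz_derive (F := fun s => Im (cexp c s))
    (F' := fun s => Im (c * cexp c s)) (K := l1norm c * (2 * expR `|Re c|)) _ _ _) _.
  + by move=> u; have [] := cexp_derive c u.
  + by rewrite -subr_ge0.
  + by move=> u /H/bnd; apply: le_trans; exact: normIm_le.
  + by rewrite ler_wpM2l// mulr_ge0 ?l1norm_ge0// mulr_ge0// expR_ge0.
Qed.

Definition cintegrable f :=
  mu.-integrable `[(0 : R), 1[ (EFin \o (fun t => Re (f t))) /\
  mu.-integrable `[(0 : R), 1[ (EFin \o (fun t => Im (f t))).

Definition cprimitive f t : R[i] :=
  (primitive (fun t => Re (f t)) t +i* primitive (fun t => Im (f t)) t)%C.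

Lemma cprimitive0 f : cprimitive f 0 = 0.
Proof. by rewrite /cprimitive !primitive0. Qed.

Lemma cprimitive_abs_cont f b : cintegrable f -> cabs_cont (cprimitive f) 0 b.
Proof. by move=> [fR fI]; split; exact: primitive_abs_cont. Qed.

Lemma ae_and2 (P Q : R -> Prop) :
  {ae mu, forall t, P t} -> {ae mu, forall t, Q t} -> {ae mu, forall t, P t /\ Q t}.
Proof.
apply: filterS2; first exact: (ae_filter_ringOfSetsType mu).
by [].
Qed.

Lemma ae_impl (P Q : R -> Prop) : (forall t, P t -> Q t) ->
  {ae mu, forall t, P t} -> {ae mu, forall t, Q t}.
Proof. by apply: filterS; exact: (ae_filter_ringOfSetsType mu). Qed.

Lemma cprimitive_derive f : cintegrable f ->
  {ae mu, forall t, 0 < t < 1 -> cderive (cprimitive f) t (f t)}.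
Proof.
move=> [/primitive_derive fR /primitive_derive fI].
by apply: ae_impl (ae_and2 fR fI) => t [H1 H2] t01; split; [exact: H1|exact: H2].
Qed.

Lemma integrable01D (F G : R -> R) :
  mu.-integrable `[(0 : R), 1[ (EFin \o F) ->
  mu.-integrable `[(0 : R), 1[ (EFin \o G) ->
  mu.-integrable `[(0 : R), 1[ (EFin \o (fun t => F t + G t)).
Proof.
move=> hF hG.
rewrite (_ : EFin \o _ = (EFin \o F) \+ (EFin \o G))%E//.
exact: integrableD.
Qed.

Lemma cintegrable_norm f : cintegrable f ->
  mu.-integrable `[(0 : R), 1[ (EFin \o (fun t => l1norm (f t))).
Proof.
by move=> [/integrable_norm fR /integrable_norm fI]; exact: integrable01D.
Qed.

Lemma cprimitive_bound f t : cintegrable f ->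
  l1norm (cprimitive f t) <= \int[mu]_(s in `[0, 1[) l1norm (f s).
Proof.
move=> [fR fI]; rewrite RintegralD//; last 2 first.
  exact: (integrable_norm fR).
  exact: (integrable_norm fI).
by apply: lerD; exact: primitive_bound.
Qed.

Lemma abs_cont_on_derive_eq (F G : R -> R) (f : R -> R) b : 0 <= b -> b <= 1 ->
  abs_cont_on F 0 b -> abs_cont_on G 0 b ->
  {ae mu, forall t, 0 < t < 1 -> is_derive t (1 : R) F (f t)} ->
  {ae mu, forall t, 0 < t < 1 -> is_derive t (1 : R) G (f t)} ->
  F b - F 0 = G b - G 0.
Proof.
move=> b0 b1 acF acG dF dG.
have acN : abs_cont_on (fun t => F t - G t) 0 b.
  apply: abs_cont_onD => // e e0; have [d d0 H] := acG e e0; exists d => // m l r lr tI s.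
  have := H m l r lr tI s; congr (_ < _); apply: eq_bigr => i _.
  by rewrite -opprD normrN.
suff : F b - G b = F 0 - G 0 by lra.
apply: (abs_cont_derive0 b0 acN).
apply: ae_impl (ae_and2 dF dG) => t [H1 H2] /andP[t0 tb].
have t01 : 0 < t < 1 by rewrite t0 (lt_le_trans tb).
rewrite -(subrr (f t)); exact: (is_deriveB (H1 t01) (H2 t01)).
Qed.

(** The fundamental theorem of calculus in the absolutely continuous class: both sides have the same
    derivative almost everywhere, hence the same increments. It turns Green's identity, known almost
    everywhere, into an equality at every point. *)
Lemma cprimitiveE f g b : 0 <= b -> b <= 1 -> cabs_cont f 0 b -> cintegrable g ->
  {ae mu, forall t, 0 < t < 1 -> cderive f t (g t)} ->
  f b = f 0 + cprimitive g b.
Proof.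
move=> b0 b1 [fR fI] intg df.
have [pR pI] := cprimitive_abs_cont b intg.
have dp := cprimitive_derive intg.
have HR : Re (f b) - Re (f 0) = Re (cprimitive g b) - Re (cprimitive g 0).
  apply: (abs_cont_on_derive_eq (f := fun t => Re (g t)) b0 b1 fR pR).
    by apply: ae_impl df => t H /H [].
  by apply: ae_impl dp => t H /H [].
have HI : Im (f b) - Im (f 0) = Im (cprimitive g b) - Im (cprimitive g 0).
  apply: (abs_cont_on_derive_eq (f := fun t => Im (g t)) b0 b1 fI pI).
    by apply: ae_impl df => t H /H [].
  by apply: ae_impl dp => t H /H [].
move: HR HI; rewrite !cprimitive0 !subr0 => HR HI.
apply: complexP; rewrite ?ReD ?ImD -?HR -?HI; ring.
Qed.

End complex_abs_cont.

(** * The Dirac operator *)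

Lemma ord2P (P : 'I_2 -> Prop) : P 0 -> P 1 -> forall i, P i.
Proof.
by move=> P0 P1 [[|[|//]] lt]; [move: P0|move: P1]; congr P; exact/val_inj.
Qed.

Section dirac_operator.
Context (R : realType).
Local Notation Re := (@complex.Re R).
Local Notation Im := (@complex.Im R).
Notation mu := (@lebesgue_measure R).
Local Notation I01 := (`[(0 : R), 1[%classic).
Variables (X Y : R -> R) (T : R).
Implicit Types (v g : R -> 'cV[R]_2) (w k h : R -> 'cV[R[i]]_2) (t s : R).

Let r11 t := weight X Y t 0 0.
Let r12 t := weight X Y t 0 1.
Let r22 t := weight X Y t 1 1.

Hypothesis Y_gt0 : forall t, 0 <= t < 1 -> 0 < Y t.
Hypothesis mr11 : measurable_fun I01 r11.
Hypothesis mr12 : measurable_fun I01 r12.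
Hypothesis mr22 : measurable_fun I01 r22.
(** As the determinant is 1/4 at every point, a bound on the trace controls both eigenvalues, from
    above and away from 0. The weighted norm is then equivalent to the unweighted one, which reduces
    all later questions of integrability to ordinary ones. *)
Hypothesis trace_le : forall t, 0 <= t < 1 -> r11 t + r22 t <= T.

Let r21E t : weight X Y t 1 0 = r12 t. Proof. by rewrite /r12 !mxE. Qed.

Let detW t : 0 <= t < 1 -> r11 t * r22 t - r12 t ^+ 2 = 4^-1.
Proof.
move=> /Y_gt0/gt_eqF/negbT Yt; rewrite /r11 /r22 /r12 !mxE /=.
by field; rewrite Yt.
Qed.

Let r11_gt0 t : 0 <= t < 1 -> 0 < r11 t.
Proof. by move=> /Y_gt0 Yt; rewrite /r11 !mxE /= mulr1 invr_gt0 mulr_gt0. Qed.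

Let r22_gt0 t : 0 <= t < 1 -> 0 < r22 t.
Proof.
move=> /Y_gt0 Yt; rewrite /r22 !mxE /= mulr_gt0 ?invr_gt0 ?mulr_gt0//.
by rewrite ltr_wpDl ?sqr_ge0// exprn_gt0.
Qed.

Let quad t (a b : R) := r11 t * a ^+ 2 + 2 * r12 t * a * b + r22 t * b ^+ 2.

Lemma quadE v t :
  ((v t)^T *m weight X Y t *m v t) 0 0 = quad t (v t 0 0) (v t 1 0).
Proof.
rewrite !mxE !big_ord_recl big_ord0 !mxE !big_ord_recl !big_ord0.
rewrite /quad ![(v t)^T _ _]mxE.
rewrite (_ : lift ord0 ord0 = 1); last exact/val_inj.
rewrite -![weight X Y t ord0 _]/(weight X Y t 0 _) r21E -/(r11 t) -/(r12 t) -/(r22 t).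
by rewrite -![v t ord0 _]/(v t 0 0); ring.
Qed.

(* By Cayley-Hamilton tr(W) <a, W a> = |W a|^2 + det W |a|^2 with det W = 1/4. *)
Lemma quad_lower t a b : 0 <= t < 1 -> a ^+ 2 + b ^+ 2 <= 4 * T * quad t a b.
Proof.
move=> t01; have q0 : (r11 t + r22 t) * quad t a b =
  (r11 t * a + r12 t * b) ^+ 2 + (r12 t * a + r22 t * b) ^+ 2
  + (r11 t * r22 t - r12 t ^+ 2) * (a ^+ 2 + b ^+ 2) by rewrite /quad; ring.
have H : (a ^+ 2 + b ^+ 2) <= 4 * ((r11 t + r22 t) * quad t a b).
  rewrite q0 detW//.
  have := sqr_ge0 (r11 t * a + r12 t * b); have := sqr_ge0 (r12 t * a + r22 t * b).
  lra.
apply: le_trans H _; rewrite -mulrA ler_wpM2l// ler_wpM2r ?trace_le//.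
have tr0 : 0 < r11 t + r22 t by rewrite addr_gt0 ?r11_gt0 ?r22_gt0.
rewrite -(pmulr_rge0 _ tr0) q0 detW// !addr_ge0 ?sqr_ge0//.
by rewrite mulr_ge0// addr_ge0// sqr_ge0.
Qed.

(** What [quad] lacks to reach tr(W) times the squared length is the quadratic form of the adjugate
    of W, again positive definite; multiplied by [r22] it becomes a sum of squares. *)
Lemma quad_upper t a b : 0 <= t < 1 -> quad t a b <= T * (a ^+ 2 + b ^+ 2).
Proof.
move=> t01; apply: le_trans (_ : (r11 t + r22 t) * (a ^+ 2 + b ^+ 2) <= _); last first.
  by rewrite ler_wpM2r ?trace_le// addr_ge0// sqr_ge0.
have -> : (r11 t + r22 t) * (a ^+ 2 + b ^+ 2) = quad t a b +
    (r22 t * a ^+ 2 - 2 * r12 t * a * b + r11 t * b ^+ 2) by rewrite /quad; ring.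
rewrite lerDl -(pmulr_rge0 _ (r22_gt0 t01)).
have -> : r22 t * (r22 t * a ^+ 2 - 2 * r12 t * a * b + r11 t * b ^+ 2) =
  (r22 t * a - r12 t * b) ^+ 2 + (r11 t * r22 t - r12 t ^+ 2) * b ^+ 2 by ring.
by rewrite detW// addr_ge0 ?sqr_ge0// mulr_ge0// sqr_ge0.
Qed.

Lemma quad_ge0 t a b : 0 <= t < 1 -> 0 <= quad t a b.
Proof.
move=> t01; rewrite -(pmulr_rge0 _ (r11_gt0 t01)).
have -> : r11 t * quad t a b =
  (r11 t * a + r12 t * b) ^+ 2 + (r11 t * r22 t - r12 t ^+ 2) * b ^+ 2
  by rewrite /quad; ring.
by rewrite detW// addr_ge0 ?sqr_ge0// mulr_ge0// sqr_ge0.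
Qed.

Lemma T_ge0 : 0 <= T.
Proof.
have t01 : 0 <= (0 : R) < 1 by rewrite lexx ltr01.
by apply: le_trans (trace_le t01); rewrite addr_ge0 ?ltW ?r11_gt0 ?r22_gt0.
Qed.

Lemma entries_le t : 0 <= t < 1 -> [/\ `|r11 t| <= T, `|r12 t| <= T & `|r22 t| <= T].
Proof.
move=> t01; have := trace_le t01; have p := r11_gt0 t01; have q := r22_gt0 t01.
have := detW t01; move=> D tr; split.
- by rewrite gtr0_norm//; lra.
(* By the determinant, [r12 ^+ 2 <= r11 * r22], which is at most a quarter of the squared trace. *)
- rewrite -(@ler_pXn2r _ 2)// ?nnegrE ?T_ge0// real_normK ?num_real//.
  have : (r11 t + r22 t) ^+ 2 <= T ^+ 2.
    by rewrite ler_pXn2r// ?nnegrE ?T_ge0//; lra.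
  have : 0 <= r11 t * r22 t by rewrite mulr_ge0// ltW.
  have := sqr_ge0 (r11 t - r22 t); nra.
- by rewrite gtr0_norm//; lra.
Qed.

(** Since [J^2 = -1], the equation [W g = J v'] solves to [v' = - J W g]; this is the first-order
    system on which everything below works. *)
Lemma tauE t (g dv : 'cV[R]_2) : 0 <= t < 1 ->
  g = invmx (weight X Y t) *m (Jmx R *m dv) <->
  dv 0 0 = r12 t * g 0 0 + r22 t * g 1 0 /\
  dv 1 0 = - (r11 t * g 0 0 + r12 t * g 1 0).
Proof.
move=> t01; have D := detW t01.
(* The inverse is the adjugate divided by the determinant 1/4. *)
have Wu : weight X Y t \in unitmx.
  have /mulmx1_unit[] : weight X Y t *m
     (4 *: mx2 (r22 t) (- r12 t) (- r12 t) (r11 t)) = 1%:M; last by [].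
  apply/matrixP => i j; rewrite !mxE big_ord_recl big_ord1.
  rewrite (_ : lift ord0 ord0 = 1); last exact/val_inj.
  elim/ord2P: i; elim/ord2P: j; rewrite ?r21E -/(r11 t) -/(r12 t) -/(r22 t) !mxE /=;
    rewrite ?r21E -/(r11 t) -/(r12 t) -/(r22 t) ?mulr1n ?mulr0n; lra.
have -> : (g = invmx (weight X Y t) *m (Jmx R *m dv)) <->
          weight X Y t *m g = Jmx R *m dv.
  by split=> [->|<-]; rewrite ?mulKVmx ?mulKmx.
have E0 : (weight X Y t *m g) 0 0 = r11 t * g 0 0 + r12 t * g 1 0.
  rewrite mxE big_ord_recl big_ord1.
  by rewrite (_ : lift ord0 ord0 = 1)//; exact/val_inj.
have E1 : (weight X Y t *m g) 1 0 = r12 t * g 0 0 + r22 t * g 1 0.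
  rewrite mxE big_ord_recl big_ord1 r21E.
  by rewrite (_ : lift ord0 ord0 = 1)//; exact/val_inj.
have F0 : (Jmx R *m dv) 0 0 = - dv 1 0.
  rewrite mxE big_ord_recl big_ord1 !mxE /= mul0r add0r mulN1r.
  by rewrite (_ : lift ord0 ord0 = 1)//; exact/val_inj.
have F1 : (Jmx R *m dv) 1 0 = dv 0 0.
  by rewrite mxE big_ord_recl big_ord1 !mxE /= mul0r addr0 mul1r.
split=> [/matrixP E|[E0' E1']].
  by rewrite -E1 -E0 !E F0 F1 opprK.
by apply/matrixP => i j; rewrite ord1; elim/ord2P: i;
  rewrite ?E0 ?E1 ?F0 ?F1 ?E0' ?E1' ?opprK.
Qed.

Let mI : measurable (I01 : set (measurableTypeR R)). Proof. by []. Qed.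

Let muI01 : (mu I01 = 1)%E.
Proof. by rewrite lebesgue_measure_itv/= lte_fin ltr01 oppr0 adde0. Qed.

(** * Weighted and ordinary square integrability *)

Definition sqsum v t : R := v t 0 0 ^+ 2 + v t 1 0 ^+ 2.
Definition sqint v : \bar R := (\int[mu]_(t in I01) (sqsum v t)%:E)%E.
Definition mcomp v := forall i : 'I_2, measurable_fun I01 (fun t : R => v t i 0 : R).

Lemma sqsum_ge0 v t : 0 <= sqsum v t. Proof. by rewrite addr_ge0 ?sqr_ge0. Qed.

Lemma sqint_ge0 v : (0 <= sqint v)%E.
Proof. by apply: integral_ge0 => t _; rewrite lee_fin sqsum_ge0. Qed.

Lemma measurable_sqsum v : mcomp v -> measurable_fun I01 (sqsum v).
Proof.
by move=> mv; apply: measurable_funD; apply: measurable_funX; exact: mv.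
Qed.

Let measurable_quad v : mcomp v ->
  measurable_fun I01 (fun t => quad t (v t 0 0) (v t 1 0)).
Proof.
move=> mv; apply: measurable_funD; last first.
  by apply: measurable_funM => //; apply: measurable_funX; exact: mv.
apply: measurable_funD.
  by apply: measurable_funM => //; apply: measurable_funX; exact: mv.
apply: measurable_funM; last exact: mv.
apply: measurable_funM; last exact: mv.
by apply: measurable_funM => //; exact: measurable_cst.
Qed.

Lemma sqnormE v :
  sqnorm X Y v = (\int[mu]_(t in I01) (quad t (v t 0 0) (v t 1 0))%:E)%E.
Proof. by apply: eq_integral => t _; rewrite quadE. Qed.

Lemma sqnorm_ge0 v : (0 <= sqnorm X Y v)%E.
Proof.
by rewrite sqnormE; apply: integral_ge0 => t; rewrite /= in_itv/= lee_fin => /quad_ge0.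
Qed.

Lemma sqnorm_ub v : mcomp v -> (sqnorm X Y v <= T%:E * sqint v)%E.
Proof.
move=> mv; rewrite sqnormE -ge0_integralZl_EFin//; last 3 first.
- by move=> t _; rewrite lee_fin sqsum_ge0.
- by apply/measurable_EFinP; exact: measurable_sqsum.
- exact: T_ge0.
apply: ge0_le_integral => //.
- by move=> t; rewrite /= in_itv/= lee_fin => /quad_ge0.
- by apply/measurable_EFinP; exact: measurable_quad.
- apply/measurable_EFinP/measurable_funM; first exact: measurable_cst.
  exact: measurable_sqsum.
- by move=> t; rewrite /= in_itv/= lee_fin => /quad_upper.
Qed.

Lemma sqint_ub v : mcomp v -> (sqint v <= (4 * T)%:E * sqnorm X Y v)%E.
Proof.
move=> mv; rewrite sqnormE -ge0_integralZl_EFin//; last 3 first.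
- by move=> t; rewrite /= in_itv/= lee_fin => /quad_ge0.
- by apply/measurable_EFinP; exact: measurable_quad.
- by rewrite mulr_ge0// T_ge0.
apply: ge0_le_integral => //.
- by move=> t _; rewrite lee_fin sqsum_ge0.
- by apply/measurable_EFinP; exact: measurable_sqsum.
- apply/measurable_EFinP/measurable_funM; first exact: measurable_cst.
  exact: measurable_quad.
- by move=> t; rewrite /= in_itv/= lee_fin => t01; exact: quad_lower.
Qed.

Lemma in_L2P v : in_L2 X Y v <-> mcomp v /\ (sqint v < +oo)%E.
Proof.
split=> [[mv fv]|[mv fv]]; split=> //.
- apply: le_lt_trans (sqint_ub mv) _; have := sqnorm_ge0 v.
  case: (sqnorm X Y v) fv => [r _ _| |]//; by rewrite -EFinM ltry.
- apply: le_lt_trans (sqnorm_ub mv) _; have := sqint_ge0 v.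
  case: (sqint v) fv => [r _ _| |]//; by rewrite -EFinM ltry.
Qed.

Lemma in_L2_comb (a b : R) v v' : in_L2 X Y v -> in_L2 X Y v' ->
  in_L2 X Y (fun t => a *: v t + b *: v' t).
Proof.
move=> /in_L2P[mv fv] /in_L2P[mv' fv']; apply/in_L2P.
have mvv' : mcomp (fun t => a *: v t + b *: v' t).
  move=> i; rewrite (_ : (fun t => _) = (fun t => a * v t i 0 + b * v' t i 0)).
    by apply: measurable_funD; apply: measurable_funM => //; exact: measurable_cst.
  by apply/funext => t; rewrite !mxE.
split=> //; pose c := 2 * (a ^+ 2 + b ^+ 2).
have c0 : 0 <= c by rewrite mulr_ge0// addr_ge0// sqr_ge0.
apply: (@le_lt_trans _ _ (\int[mu]_(t in I01) (c%:E * ((sqsum v t)%:E + (sqsum v' t)%:E)))%E).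
  apply: ge0_le_integral => //.
  - by move=> t _; rewrite lee_fin sqsum_ge0.
  - by apply/measurable_EFinP; exact: measurable_sqsum.
  - apply/measurable_EFinP/measurable_funM; first exact: measurable_cst.
    by apply: measurable_funD; exact: measurable_sqsum.
  - move=> t _; rewrite -EFinD -EFinM lee_fin /sqsum !mxE.
    have H p q : (a * p + b * q) ^+ 2 <= c * (p ^+ 2 + q ^+ 2).
      have := sqr_ge0 (a * p - b * q); have := mulr_ge0 (sqr_ge0 a) (sqr_ge0 q).
      have := mulr_ge0 (sqr_ge0 b) (sqr_ge0 p); rewrite /c.
      lra.
    have := H (v t 0 0) (v' t 0 0); have := H (v t 1 0) (v' t 1 0); lra.
rewrite ge0_integralZl_EFin//; last 2 first.
- by move=> t _; rewrite -EFinD lee_fin addr_ge0// sqsum_ge0.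
- apply/measurable_EFinP/measurable_funD; exact: measurable_sqsum.
rewrite ge0_integralD//; first last.
- by apply/measurable_EFinP; exact: measurable_sqsum.
- by move=> t _; rewrite lee_fin sqsum_ge0.
- by apply/measurable_EFinP; exact: measurable_sqsum.
- by move=> t _; rewrite lee_fin sqsum_ge0.
rewrite -/(sqint v) -/(sqint v').
have := sqint_ge0 v; have := sqint_ge0 v'.
case: (sqint v) fv => [r _| |]//; case: (sqint v') fv' => [r' _| |]// _ _.
by rewrite -EFinD -EFinM ltry.
Qed.

Lemma in_L2_bounded v K : mcomp v ->
  (forall t i, 0 <= t < 1 -> `|v t i 0| <= K) -> in_L2 X Y v.
Proof.
move=> mv bv; apply/in_L2P; split=> //.
apply: (@le_lt_trans _ _ (\int[mu]_(t in I01) (K ^+ 2 + K ^+ 2)%:E)%E).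
  apply: ge0_le_integral => //.
  - by move=> t _; rewrite lee_fin sqsum_ge0.
  - by apply/measurable_EFinP; exact: measurable_sqsum.
  - move=> t; rewrite /= in_itv/= => t01; rewrite lee_fin lerD//.
    + rewrite -real_normK ?num_real//; apply: lerXn2r; rewrite ?nnegrE ?bv//.
      by rewrite (le_trans _ (bv t 0 t01)).
    + rewrite -real_normK ?num_real//; apply: lerXn2r; rewrite ?nnegrE ?bv//.
      by rewrite (le_trans _ (bv t 0 t01)).
by rewrite integral_cst// [X in (_ * X < _)%E]muI01 mule1 ltry.
Qed.

Definition cmeas (f : R -> R[i]) :=
  measurable_fun I01 (fun t => Re (f t)) /\ measurable_fun I01 (fun t => Im (f t)).

Lemma cmeasD (f g : R -> R[i]) : cmeas f -> cmeas g -> cmeas (fun t => f t + g t).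
Proof.
move=> [fR fI] [gR gI]; split.
- rewrite (_ : (fun t => _) = (fun t => Re (f t) + Re (g t))).
    exact: measurable_funD.
  by apply/funext => t; rewrite ReD.
- rewrite (_ : (fun t => _) = (fun t => Im (f t) + Im (g t))).
    exact: measurable_funD.
  by apply/funext => t; rewrite ImD.
Qed.

Lemma cmeasM (f g : R -> R[i]) : cmeas f -> cmeas g -> cmeas (fun t => f t * g t).
Proof.
move=> [fR fI] [gR gI]; split.
- rewrite (_ : (fun t => _) = (fun t => Re (f t) * Re (g t) - Im (f t) * Im (g t))).
    by apply: measurable_funB; apply: measurable_funM.
  by apply/funext => t; rewrite ReM.
- rewrite (_ : (fun t => _) = (fun t => Re (f t) * Im (g t) + Im (f t) * Re (g t))).
    by apply: measurable_funD; apply: measurable_funM.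
  by apply/funext => t; rewrite ImM.
Qed.

Lemma cmeas_cst (c : R[i]) : cmeas (fun=> c).
Proof. by split; exact: measurable_cst. Qed.

Lemma cmeasC (f : R -> R) : measurable_fun I01 f -> cmeas (fun t => (f t)%:C%C).
Proof. by move=> mf; split => //; exact: measurable_cst. Qed.

Lemma cmeasN (f : R -> R[i]) : cmeas f -> cmeas (fun t => - f t).
Proof.
move=> mf; rewrite (_ : (fun t => _) = (fun t => (-1) * f t)).
  by apply: cmeasM mf; exact: cmeas_cst.
by apply/funext => t; rewrite mulN1r.
Qed.

Lemma cabs_cont_cmeas f : cabs_cont f 0 1 -> cmeas f.
Proof.
have sub : I01 `<=` `[(0 : R), 1] by apply: subset_itvl; rewrite bnd_simp.
by move=> [fR fI]; split; apply: measurable_funS sub _ => //; exact: abs_cont_on_measurable.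
Qed.

Definition mass k t : R := l1norm (k t 0 0) + l1norm (k t 1 0).

Lemma mass_ge0 k t : 0 <= mass k t. Proof. by rewrite addr_ge0 ?l1norm_ge0. Qed.

Lemma in_L2C_cmeas k i : in_L2C X Y k -> cmeas (fun t => k t i 0).
Proof.
move=> [[mR _] [mI' _]]; split.
- by have := mR i; congr (measurable_fun _ _); apply/funext => t; rewrite mxE.
- by have := mI' i; congr (measurable_fun _ _); apply/funext => t; rewrite mxE.
Qed.

Lemma measurable_l1norm f : cmeas f -> measurable_fun I01 (fun t => l1norm (f t)).
Proof.
by move=> [fR fI]; apply: measurable_funD; exact: measurableT_comp.
Qed.

Lemma measurable_mass k : in_L2C X Y k -> measurable_fun I01 (mass k).
Proof.
by move=> hk; apply: measurable_funD; apply: measurable_l1norm; exact: in_L2C_cmeas.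
Qed.

Lemma mass_sq k t :
  mass k t ^+ 2 <= 4 * (sqsum (re_part k) t + sqsum (im_part k) t).
Proof.
rewrite /mass /l1norm /sqsum !mxE.
rewrite -![Re _ ^+ 2]real_normK ?num_real// -![Im _ ^+ 2]real_normK ?num_real//.
set a := `|Re (k t 0 0)|; set b := `|Im (k t 0 0)|.
set c := `|Re (k t 1 0)|; set d := `|Im (k t 1 0)|.
have := sqr_ge0 (a - b); have := sqr_ge0 (a - c); have := sqr_ge0 (a - d).
have := sqr_ge0 (b - c); have := sqr_ge0 (b - d); have := sqr_ge0 (c - d).
lra.
Qed.

Lemma sqsum_mass k t :
  sqsum (re_part k) t + sqsum (im_part k) t <= mass k t ^+ 2.
Proof.
rewrite /mass /l1norm /sqsum !mxE.
rewrite -![Re _ ^+ 2]real_normK ?num_real// -![Im _ ^+ 2]real_normK ?num_real//.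
set a := `|Re (k t 0 0)|; set b := `|Im (k t 0 0)|.
set c := `|Re (k t 1 0)|; set d := `|Im (k t 1 0)|.
have [a0 b0 c0 d0] : [/\ 0 <= a, 0 <= b, 0 <= c & 0 <= d] by split; exact: normr_ge0.
have := mulr_ge0 a0 b0; have := mulr_ge0 a0 c0; have := mulr_ge0 a0 d0.
have := mulr_ge0 b0 c0; have := mulr_ge0 b0 d0; have := mulr_ge0 c0 d0.
lra.
Qed.

Let sqintC k : \bar R := (sqint (re_part k) + sqint (im_part k))%E.

(** The integral over an interval of measure 1 of [2 J m <= J^2 + m^2]. With [J = 1] it shows that
    [mass k] is integrable; with [J = tmass k] it is the Cauchy-Schwarz inequality. *)
Let int_mass k J : in_L2C X Y k -> 0 <= J ->
  (\int[mu]_(t in I01) (2 * J * mass k t)%:E <= (J ^+ 2)%:E + 4%:E * sqintC k)%E.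
Proof.
move=> hk J0; have [/in_L2P[mR _] /in_L2P[mI' _]] := hk.
have m2 : measurable_fun I01 (fun t => sqsum (re_part k) t + sqsum (im_part k) t).
  by apply: measurable_funD; exact: measurable_sqsum.
have s0 t : 0 <= sqsum (re_part k) t + sqsum (im_part k) t.
  by rewrite addr_ge0 ?sqsum_ge0.
have -> : ((J ^+ 2)%:E + 4%:E * sqintC k =
  \int[mu]_(t in I01) ((J ^+ 2)%:E +
    4%:E * (sqsum (re_part k) t + sqsum (im_part k) t)%:E))%E.
  rewrite ge0_integralD//; last 3 first.
  - by move=> t _; rewrite lee_fin sqr_ge0.
  - by move=> t _; rewrite -EFinM lee_fin mulr_ge0.
  - apply/measurable_EFinP/measurable_funM => //; exact: measurable_cst.
  rewrite integral_cst// [X in (_ * X + _)%E]muI01 mule1; congr (_ + _)%E.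
  rewrite ge0_integralZl_EFin//; last 2 first.
  - by move=> t _; rewrite lee_fin s0.
  - by apply/measurable_EFinP.
  congr (_ * _)%E; rewrite /sqintC /sqint -ge0_integralD//.
  - by move=> t _; rewrite lee_fin sqsum_ge0.
  - by apply/measurable_EFinP; exact: measurable_sqsum.
  - by move=> t _; rewrite lee_fin sqsum_ge0.
  - by apply/measurable_EFinP; exact: measurable_sqsum.
apply: ge0_le_integral => //.
- by move=> t _; rewrite lee_fin !mulr_ge0// mass_ge0.
- apply/measurable_EFinP/measurable_funM; first exact: measurable_cst.
  exact: measurable_mass.
- apply/measurable_EFinP; apply: measurable_funD; first exact: measurable_cst.
  by apply: measurable_funM => //; exact: measurable_cst.
- move=> t _; rewrite -EFinM -EFinD lee_fin.
  have := mass_sq k t; have := sqr_ge0 (J - mass k t); lra.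
Qed.

Lemma integrable_mass k : in_L2C X Y k -> mu.-integrable I01 (EFin \o mass k).
Proof.
move=> hk; apply/integrableP; split.
  by apply/measurable_EFinP; exact: measurable_mass.
have := int_mass hk ler01; have [/in_L2P[_ fR] /in_L2P[_ fI]] := hk.
have := sqint_ge0 (re_part k); have := sqint_ge0 (im_part k).
rewrite /sqintC; case: (sqint (re_part k)) fR => [r _| |]//.
case: (sqint (im_part k)) fI => [r' _| |]// _ _ H.
have : (\int[mu]_(t in I01) (2 * 1 * mass k t)%:E < +oo)%E.
  by apply: le_lt_trans H _; exact: ltry.
move=> H'; apply: le_lt_trans H'; apply: ge0_le_integral => //.
- apply/measurable_EFinP; apply: measurableT_comp => //; exact: measurable_mass.
- apply/measurable_EFinP/measurable_funM; first exact: measurable_cst.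
  exact: measurable_mass.
- move=> t _; rewrite lee_fin ger0_norm ?mass_ge0// mulr1.
  have := mass_ge0 k t; lra.
Qed.

Definition tmass k : R := \int[mu]_(t in I01) mass k t.

Lemma tmass_ge0 k : 0 <= tmass k.
Proof. by apply: Rintegral_ge0 => t _; exact: mass_ge0. Qed.

(** The constant is the product of the 4 of [mass_sq] and the [4 * T] of [sqint_ub]. *)
Lemma tmass_sq k : in_L2C X Y k ->
  ((tmass k ^+ 2)%:E <= (16 * T)%:E * sqnormC X Y k)%E.
Proof.
move=> hk; have := int_mass hk (tmass_ge0 k).
have fin : (\int[mu]_(t in I01) (mass k t)%:E = (tmass k)%:E)%E.
  by rewrite /tmass /Rintegral fineK// integrable_fin_num//; exact: integrable_mass.
under eq_integral do rewrite EFinM.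
rewrite ge0_integralZl_EFin//; last 3 first.
- by move=> t _; rewrite lee_fin mass_ge0.
- by apply/measurable_EFinP; exact: measurable_mass.
- by rewrite mulr_ge0// tmass_ge0.
rewrite fin; have [hR hI] := hk; have [/in_L2P[mR fR] /in_L2P[mI' fI]] := hk.
have := sqint_ub mR; have := sqint_ub mI'.
have := sqint_ge0 (re_part k); have := sqint_ge0 (im_part k).
have := sqnorm_ge0 (re_part k); have := sqnorm_ge0 (im_part k).
rewrite /sqintC /sqnormC.
case: (sqint (re_part k)) fR => [r _| |]//.
case: (sqint (im_part k)) fI => [r' _| |]//.
case: (sqnorm X Y (re_part k)) hR.2 => [s _| |]//.
case: (sqnorm X Y (im_part k)) hI.2 => [s' _| |]// _ _ _ _.
rewrite ![(_ <= _)%E]lee_fin => H1 H2 H3.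
move: H1 H2 H3; rewrite /=; lra.
Qed.

Lemma cintegrable_mass k f K : in_L2C X Y k -> cmeas f ->
  (forall t, 0 <= t < 1 -> l1norm (f t) <= K * mass k t) ->
  cintegrable f /\ \int[mu]_(t in I01) l1norm (f t) <= K * tmass k.
Proof.
move=> hk [fR fI] bf.
have intK : mu.-integrable I01 (EFin \o (fun t => K * mass k t)).
  rewrite (_ : EFin \o _ = fun t => (K%:E * (EFin \o mass k) t)%E)//.
  by apply: integrableZl => //; exact: integrable_mass.
have cf : cintegrable f.
  split.
  - apply: (le_integrable _ _ _ intK) => //; first exact/measurable_EFinP.
    move=> t; rewrite /= in_itv/= => t01; rewrite lee_fin.
    apply: le_trans (normRe_le _) _; apply: le_trans (bf _ t01) (ler_norm _).
  - apply: (le_integrable _ _ _ intK) => //; first exact/measurable_EFinP.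
    move=> t; rewrite /= in_itv/= => t01; rewrite lee_fin.
    apply: le_trans (normIm_le _) _; apply: le_trans (bf _ t01) (ler_norm _).
split=> //; rewrite /tmass -RintegralZl//; last exact: integrable_mass.
apply: le_Rintegral => //; first exact: cintegrable_norm.
Qed.

(** * The operator as a complex first-order system *)

Let tau1 t (a b : R[i]) : R[i] := (r12 t)%:C%C * a + (r22 t)%:C%C * b.
Let tau2 t (a b : R[i]) : R[i] := - ((r11 t)%:C%C * a + (r12 t)%:C%C * b).

(** The equation [(tau - z) (p, q) = (ka, kb)]: [tau1] and [tau2] are the components of [- J W]
    applied to [z (p, q) + (ka, kb)]. *)
Definition dirac_system (z : R[i]) (p q ka kb : R -> R[i]) :=
  {ae mu, forall t, 0 < t < 1 ->
    cderive p t (tau1 t (z * p t + ka t) (z * q t + kb t)) /\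
    cderive q t (tau2 t (z * p t + ka t) (z * q t + kb t))}.

Let reZ (a : R) (z : R[i]) : Re (a%:C%C * z) = a * Re z.
Proof. by rewrite ReM /= mul0r subr0. Qed.

Let imZ (a : R) (z : R[i]) : Im (a%:C%C * z) = a * Im z.
Proof. by rewrite ImM /= mul0r addr0. Qed.

Let reN (z : R[i]) : Re (- z) = - Re z. Proof. by case: z. Qed.
Let imN (z : R[i]) : Im (- z) = - Im z. Proof. by case: z. Qed.

(** The real and imaginary parts of the graph recombine into one complex system. Absolute continuity
    is available only on [[0, b]] with [b < 1], so the condition at 1 has to remain a limit. *)
Lemma DirC_shift_elim (u : R) (z : R[i]) w k :
  DirC_shift X Y None (Some u) z w k ->
  [/\ in_L2C X Y k,
      forall b i, 0 <= b < 1 -> cabs_cont (fun t => w t i 0) 0 b,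
      dirac_system z (fun t => w t 0 0) (fun t => w t 1 0)
        (fun t => k t 0 0) (fun t => k t 1 0),
      w 0 1 0 = 0 &
      forall e, 0 < e -> exists2 d, 0 < d & forall s, 1 - d < s < 1 ->
        l1norm (u%:C%C * w s 1 0 - w s 0 0) < e].
Proof.
move=> [hk [h [[[acR tR] mR _ bR0 bR1] [[acI tI] mI' _ bI0 bI1]] kh]].
have partR t i : re_part w t i 0 = Re (w t i 0) by rewrite mxE.
have partI t i : im_part w t i 0 = Im (w t i 0) by rewrite mxE.
split=> //.
- move=> b i /andP[b0 b1]; split.
  + by have := acR 0 b (lexx _) b1 i; apply: abs_cont_on_eq => t _; rewrite mxE.
  + by have := acI 0 b (lexx _) b1 i; apply: abs_cont_on_eq => t _; rewrite mxE.
- apply: ae_impl (ae_and2 (ae_and2 tR tI) kh) => t [[H1 H2] H3] /andP[t0 t1].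
  have t01 : 0 <= t < 1 by rewrite (ltW t0).
  have [dR dR1 /(tauE _ _ t01)[dR2 dR3]] := H1 t01.
  have [dI dI1 /(tauE _ _ t01)[dI2 dI3]] := H2 t01.
  have {}H3 i : z * w t i 0 + k t i 0 = h t i 0 by rewrite (H3 t01) !mxE; ring.
  rewrite !H3; split; split.
  + have := dR1 0; rewrite dR2 /tau1 ReD !reZ !mxE.
    by under [in X in X -> _]eq_fun do rewrite mxE.
  + have := dI1 0; rewrite dI2 /tau1 ImD !imZ !mxE.
    by under [in X in X -> _]eq_fun do rewrite mxE.
  + have := dR1 1; rewrite dR3 /tau2 reN ReD !reZ !mxE.
    by under [in X in X -> _]eq_fun do rewrite mxE.
  + have := dI1 1; rewrite dI3 /tau2 imN ImD !imZ !mxE.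
    by under [in X in X -> _]eq_fun do rewrite mxE.
- have bc v : ((v 0)^T *m Jmx R *m bdir None) 0 0 = v 0 1 0 :> R.
    rewrite !mxE big_ord_recl big_ord1 !mxE !big_ord_recl !big_ord0 !mxE /=.
    by rewrite (_ : lift ord0 ord0 = 1); [ring|exact/val_inj].
  by apply: complexP; rewrite -?partR -?partI -bc ?bR0 ?bI0.
- have bc v s : ((v s)^T *m Jmx R *m bdir (Some u)) 0 0 = u * v s 1 0 - v s 0 0 :> R.
    rewrite !mxE big_ord_recl big_ord1 !mxE !big_ord_recl !big_ord0 !mxE /=.
    by rewrite (_ : lift ord0 ord0 = 1); [ring|exact/val_inj].
  move=> e e0; have e2 : 0 < e / 2 by rewrite divr_gt0.
  have /cvgrPdist_lt/(_ _ e2) := bR1; have /cvgrPdist_lt/(_ _ e2) := bI1.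
  move=> [d1 /= d10 H1] [d2 /= d20 H2]; exists (Num.min d1 d2); first by rewrite lt_min d10.
  move=> s /andP[ds s1]; move: ds; rewrite ltrBlDr -ltrBlDl lt_min => /andP[sd1 sd2].
  rewrite /l1norm !(ReD, ImD) !reZ !imZ reN imN (splitr e).
  have := H1 s; have := H2 s; rewrite /ball_ /= gtr0_norm ?subr_gt0//.
  rewrite !bc !sub0r !normrN !partR !partI => H1' H2'.
  by apply: ltrD; [exact: H1'|exact: H2'].
Qed.

Lemma ae_left_closed (P : R -> Prop) :
  {ae mu, forall t, 0 < t < 1 -> P t} -> {ae mu, forall t, 0 <= t < 1 -> P t}.
Proof.
have n0 : {ae mu, forall t : R, t <> 0}.
  exists [set 0]; split=> //; first exact: lebesgue_measure_set1.
  by move=> t /= /contrapT.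
move=> H; apply: ae_impl (ae_and2 n0 H) => t [t0 Ht] /andP[t0' t1]; apply: Ht.
by rewrite t1 lt_neqAle t0' eq_sym andbT; apply/andP; split=> //; apply/eqP.
Qed.

Lemma abs_cont_in_L2 v : (forall i, abs_cont_on (fun t => v t i 0) 0 1) ->
  in_L2 X Y v.
Proof.
move=> acv; have bnd i := abs_cont_on_bounded ler01 (acv i).
have [K0 HK0] := bnd 0; have [K1 HK1] := bnd 1.
apply: (@in_L2_bounded _ (Num.max K0 K1)).
  move=> i; have := abs_cont_on_measurable (acv i).
  by apply: measurable_funS => //; apply: subset_itvl; rewrite bnd_simp.
move=> t i /andP[t0 t1]; have t01 : 0 <= t <= 1 by rewrite t0 ltW.
by move: i; apply: ord2P; rewrite le_max ?HK0 ?HK1// orbT.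
Qed.

Let Dir_intro (u : R) v g : (forall i, abs_cont_on (fun t => v t i 0) 0 1) ->
  in_L2 X Y g ->
  {ae mu, forall t, 0 < t < 1 ->
     is_derive t (1 : R) (fun s => v s 0 0) (r12 t * g t 0 0 + r22 t * g t 1 0) /\
     is_derive t (1 : R) (fun s => v s 1 0) (- (r11 t * g t 0 0 + r12 t * g t 1 0))} ->
  v 0 1 0 = 0 -> u * v 1 1 0 = v 1 0 0 ->
  Dir X Y None (Some u) v g.
Proof.
move=> acv hg dv v0 v1; split=> //.
- split.
    by move=> a b a0 b1 i; apply: abs_cont_on_sub (acv i) => //; exact: ltW.
  apply: ae_left_closed; apply: ae_impl dv => t Hd t01; have [d0 d1] := Hd t01.
  exists (cv2 (r12 t * g t 0 0 + r22 t * g t 1 0) (- (r11 t * g t 0 0 + r12 t * g t 1 0))).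
    by apply: ord2P; rewrite mxE.
  by apply/tauE; rewrite ?mxE//; case/andP: t01 => /ltW -> ->.
- exact: abs_cont_in_L2.
- rewrite !mxE big_ord_recl big_ord1 !mxE !big_ord_recl !big_ord0 !mxE /=.
  by rewrite (_ : lift ord0 ord0 = 1); [rewrite v0; ring|exact/val_inj].
- have bc s : ((v s)^T *m Jmx R *m bdir (Some u)) 0 0 = u * v s 1 0 - v s 0 0 :> R.
    rewrite !mxE big_ord_recl big_ord1 !mxE !big_ord_recl !big_ord0 !mxE /=.
    by rewrite (_ : lift ord0 ord0 = 1); [ring|exact/val_inj].
  apply/cvgrPdist_lt => e e0; have e2 : 0 < e / 2 / (`|u| + 1) by rewrite !divr_gt0// ltr_wpDl.
  have [d0 d00 H0] := abs_cont_on_unif (acv 0) e2.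
  have [d1 d10 H1] := abs_cont_on_unif (acv 1) e2.
  exists (Num.min (Num.min d0 d1) 1); first by rewrite /= !lt_min d00 d10 ltr01.
  move=> s /=; rewrite !lt_min => /andP[/andP[sd0 sd1]].
  move=> s1 s_lt1; move: s1; rewrite gtr0_norm ?subr_gt0// => s1.
  have s01 : 0 <= s <= 1 by rewrite (ltW s_lt1) andbT; lra.
  have one01 : 0 <= (1 : R) <= 1 by rewrite ler01 lexx.
  have u1 : 0 < `|u| + 1 by rewrite ltr_wpDl.
  have := H1 1 s one01 s01 sd1; rewrite ltr_pdivlMr// => A1.
  have := H0 1 s one01 s01 sd0; rewrite ltr_pdivlMr// => A0.
  rewrite bc sub0r normrN.
  have -> : u * v s 1 0 - v s 0 0 = (v 1 0 0 - v s 0 0) - u * (v 1 1 0 - v s 1 0).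
    by rewrite mulrBr v1; ring.
  rewrite (splitr e) (le_lt_trans (ler_normB _ _))// normrM.
  apply: ltrD.
    by apply: le_lt_trans A0; rewrite ler_peMr// lerDr.
  apply: le_lt_trans A1; rewrite mulrC ler_wpM2l// lerDl//.
Qed.

(** The functions constructed later are absolutely continuous up to 1. This gives square
    integrability at once and lets the limit at 1 be replaced by a value. *)
Lemma DirC_shift_intro (u : R) (z : R[i]) w k :
  in_L2C X Y k -> (forall i, cabs_cont (fun t => w t i 0) 0 1) ->
  dirac_system z (fun t => w t 0 0) (fun t => w t 1 0)
    (fun t => k t 0 0) (fun t => k t 1 0) ->
  w 0 1 0 = 0 -> u%:C%C * w 1 1 0 = w 1 0 0 ->
  DirC_shift X Y None (Some u) z w k.
Proof.
move=> hk acw sys w0 w1; split=> //; exists (fun t => z *: w t + k t); last first.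
  by apply/aeW => t _; rewrite addrC addKr.
have acR i : abs_cont_on (fun t => re_part w t i 0) 0 1.
  by have [H _] := acw i; apply: abs_cont_on_eq H => t _; rewrite mxE.
have acI i : abs_cont_on (fun t => im_part w t i 0) 0 1.
  by have [_ H] := acw i; apply: abs_cont_on_eq H => t _; rewrite mxE.
have hR := abs_cont_in_L2 acR; have hI := abs_cont_in_L2 acI; have [kR kI] := hk.
split; [apply: (Dir_intro acR)|apply: (Dir_intro acI)].
- have := in_L2_comb 1 1 (in_L2_comb (Re z) (- Im z) hR hI) kR.
  congr in_L2; apply/funext => t; apply/matrixP => i j.
  by rewrite !mxE !mul1r ReD ReM; ring.
- apply: ae_impl sys => t H t01; have [[H1 _] [H2 _]] := H t01.
  split.
  + move: H1; rewrite /tau1 ReD !reZ !mxE.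
    by under [in X in _ -> X]eq_fun do rewrite mxE.
  + move: H2; rewrite /tau2 reN ReD !reZ !mxE.
    by under [in X in _ -> X]eq_fun do rewrite mxE.
- by rewrite mxE w0.
- by rewrite !mxE -w1 reZ.
- have := in_L2_comb 1 1 (in_L2_comb (Im z) (Re z) hR hI) kI.
  congr in_L2; apply/funext => t; apply/matrixP => i j.
  by rewrite !mxE !mul1r ImD ImM; ring.
- apply: ae_impl sys => t H t01; have [[_ H1] [_ H2]] := H t01.
  split.
  + move: H1; rewrite /tau1 ImD !imZ !mxE.
    by under [in X in _ -> X]eq_fun do rewrite mxE.
  + move: H2; rewrite /tau2 imN ImD !imZ !mxE.
    by under [in X in _ -> X]eq_fun do rewrite mxE.
- by rewrite mxE w0.
- by rewrite !mxE -w1 imZ.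
Qed.

(* - theta^T W k for theta = (p, q): by Green's identity, the derivative of the
   Wronskian w^T J theta when tau w = z w + k and tau theta = z theta. *)
Let src (p q : R -> R[i]) k t : R[i] :=
  - (p t * ((r11 t)%:C%C * k t 0 0 + (r12 t)%:C%C * k t 1 0) +
     q t * ((r12 t)%:C%C * k t 0 0 + (r22 t)%:C%C * k t 1 0)).

Let wronskian_derive z (p q a b : R -> R[i]) k :
  dirac_system z a b (fun t => k t 0 0) (fun t => k t 1 0) ->
  dirac_system z p q (fun=> 0) (fun=> 0) ->
  {ae mu, forall t, 0 < t < 1 ->
    cderive (fun t => b t * p t - a t * q t) t (src p q k t)}.
Proof.
move=> sys sys0; apply: ae_impl (ae_and2 sys sys0) => t [H H0] t01.
have [da db] := H t01; have [dp dq] := H0 t01.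
have := cderiveD (cderiveM db dp) (cderiveZ (-1) (cderiveM da dq)).
set f := (fun s => _ + _); rewrite (_ : f = (fun t => b t * p t - a t * q t)).
  move=> H1; apply: cderive_eq H1 _; rewrite /src /tau1 /tau2; ring.
by apply/funext => s; rewrite /f mulN1r.
Qed.

Let src_cmeas p q k : in_L2C X Y k -> cabs_cont p 0 1 -> cabs_cont q 0 1 ->
  cmeas (src p q k).
Proof.
move=> hk /cabs_cont_cmeas mp /cabs_cont_cmeas mq; apply: cmeasN.
by apply: cmeasD; apply: cmeasM => //; apply: cmeasD; apply: cmeasM;
  (try exact: cmeasC); exact: in_L2C_cmeas.
Qed.

Let src_bound p q k K t : 0 <= t < 1 -> l1norm (p t) <= K -> l1norm (q t) <= K ->
  l1norm (src p q k t) <= 2 * K * T * mass k t.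
Proof.
move=> t01 pK qK; have [T11 T12 T22] := entries_le t01.
have K0 : 0 <= K by apply: le_trans (l1norm_ge0 _) pK.
have H (r r' : R) c : `|r| <= T -> `|r'| <= T -> l1norm c <= K ->
  l1norm (c * (r%:C%C * k t 0 0 + r'%:C%C * k t 1 0)) <= K * (T * mass k t).
  move=> rT rT' cK; apply: le_trans (l1normM _ _) _; apply: ler_pM => //; try exact: l1norm_ge0.
  apply: le_trans (l1normD _ _) _; rewrite /mass mulrDr; apply: lerD.
    by apply: le_trans (l1normM _ _) _; rewrite l1normC ler_wpM2r ?l1norm_ge0.
  by apply: le_trans (l1normM _ _) _; rewrite l1normC ler_wpM2r ?l1norm_ge0.
rewrite /src l1normN; apply: le_trans (l1normD _ _) _.
have := H _ _ _ T11 T12 pK; have := H _ _ _ T12 T22 qK; lra.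
Qed.

(** * The resolvent built from two solutions with nonzero Wronskian *)

Section resolvent.
Variables (u : R) (z om : R[i]) (p1 p2 q1 q2 : R -> R[i]).
Hypothesis acp1 : cabs_cont p1 0 1.
Hypothesis acp2 : cabs_cont p2 0 1.
Hypothesis acq1 : cabs_cont q1 0 1.
Hypothesis acq2 : cabs_cont q2 0 1.
Hypothesis sysp : dirac_system z p1 p2 (fun=> 0) (fun=> 0).
Hypothesis sysq : dirac_system z q1 q2 (fun=> 0) (fun=> 0).
Hypothesis wronskE : forall t, 0 <= t <= 1 -> p2 t * q1 t - p1 t * q2 t = om.
Hypothesis om_neq0 : om != 0.
Hypothesis p20 : p2 0 = 0.
Hypothesis q11 : q1 1 = u%:C%C.
Hypothesis q21 : q2 1 = 1.

Let solutions_bounded : exists2 K, 0 <= K & forall t, 0 <= t <= 1 ->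
  [/\ l1norm (p1 t) <= K, l1norm (p2 t) <= K, l1norm (q1 t) <= K & l1norm (q2 t) <= K].
Proof.
have [K1 H1] := cabs_cont_bounded ler01 acp1; have [K2 H2] := cabs_cont_bounded ler01 acp2.
have [K3 H3] := cabs_cont_bounded ler01 acq1; have [K4 H4] := cabs_cont_bounded ler01 acq2.
have H t : 0 <= t <= 1 -> [/\ l1norm (p1 t) <= Num.max (Num.max K1 K2) (Num.max K3 K4),
    l1norm (p2 t) <= Num.max (Num.max K1 K2) (Num.max K3 K4),
    l1norm (q1 t) <= Num.max (Num.max K1 K2) (Num.max K3 K4) &
    l1norm (q2 t) <= Num.max (Num.max K1 K2) (Num.max K3 K4)].
  by move=> t01; split; rewrite !le_max ?H1 ?H2 ?H3 ?H4 ?orbT.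
exists (Num.max (Num.max K1 K2) (Num.max K3 K4)) => //.
have [|le0 _ _ _] := H 0; first by rewrite lexx ler01.
by apply: le_trans le0; exact: l1norm_ge0.
Qed.

(** The Wronskian of [w] with [p] vanishes at 0 and is therefore a primitive of its source. That
    with [q] starts from an unknown value, which only the condition at 1 determines. A bound at each
    point by the L^1 norm of [k] then implies both injectivity and the L^2 bound. *)
Lemma resolvent_apriori : exists2 C, 0 <= C & forall w k,
  DirC_shift X Y None (Some u) z w k ->
  forall t, 0 <= t < 1 -> mass w t <= C * tmass k.
Proof.
have [K K0 HK] := solutions_bounded; have T0 := T_ge0.
(* Each of the two components of [w] is at most [l1norm om^-1 * (K * (2 * A) + K * A)], with [A] the
   bound [2 * K * T * tmass k] on the integral of either source. *)
exists (2 * (l1norm om^-1 * (3 * (K * (2 * K * T))))).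
  by rewrite !mulr_ge0// l1norm_ge0.
move=> w k /DirC_shift_elim[hk acw sys w0 bc].
set A := 2 * K * T * tmass k.
have HKo t : 0 <= t < 1 -> 0 <= t <= 1 by move=> /andP[-> /ltW].
pose fp t := w t 1 0 * p1 t - w t 0 0 * p2 t.
pose fq t := w t 1 0 * q1 t - w t 0 0 * q2 t.
have intp : cintegrable (src p1 p2 k) /\ \int[mu]_(t in I01) l1norm (src p1 p2 k t) <= A.
  apply: cintegrable_mass => //; first exact: src_cmeas.
  by move=> t t01; have [] := HK t (HKo _ t01) => *; exact: src_bound.
have intq : cintegrable (src q1 q2 k) /\ \int[mu]_(t in I01) l1norm (src q1 q2 k t) <= A.
  apply: cintegrable_mass => //; first exact: src_cmeas.
  by move=> t t01; have [] := HK t (HKo _ t01) => *; exact: src_bound.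
have rep (a b : R -> R[i]) t : 0 <= t < 1 -> cabs_cont a 0 1 -> cabs_cont b 0 1 ->
  dirac_system z a b (fun=> 0) (fun=> 0) -> cintegrable (src a b k) ->
  w t 1 0 * a t - w t 0 0 * b t = w 0 1 0 * a 0 - w 0 0 0 * b 0 + cprimitive (src a b k) t.
  move=> t01 aca acb sab iab; have /andP[t0 t1] := t01.
  apply: (@cprimitiveE _ (fun t => w t 1 0 * a t - w t 0 0 * b t)) => //; first exact: ltW.
    have aca' := cabs_cont_sub (lexx 0) (ltW t1) aca.
    have acb' := cabs_cont_sub (lexx 0) (ltW t1) acb.
    have acw' i := acw t i t01.
    have := cabs_contD (cabs_contM t0 (acw' 1) aca')
      (cabs_contZ (-1) t0 (cabs_contM t0 (acw' 0) acb')).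
    by congr cabs_cont; apply/funext => s; rewrite mulN1r.
  exact: (wronskian_derive sys sab).
have fpE t : 0 <= t < 1 -> fp t = cprimitive (src p1 p2 k) t.
  by move=> t01; rewrite /fp rep//; [rewrite w0 p20 !(mulr0,mul0r) subrr add0r|case: intp].
have fqE t : 0 <= t < 1 -> fq t = fq 0 + cprimitive (src q1 q2 k) t.
  by move=> t01; rewrite /fq rep//; case: intq.
have fpA t : 0 <= t < 1 -> l1norm (fp t) <= A.
  move=> t01; rewrite fpE//; apply: le_trans (cprimitive_bound _ _) intp.2.
  by case: intp.
have primq t : l1norm (cprimitive (src q1 q2 k) t) <= A.
  by apply: le_trans (cprimitive_bound _ _) intq.2; case: intq.
have wE t : 0 <= t < 1 -> w t 0 0 = om^-1 * (p1 t * fq t - q1 t * fp t) /\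
                          w t 1 0 = om^-1 * (p2 t * fq t - q2 t * fp t).
  move=> t01; have W := wronskE (HKo _ t01).
  split; apply: (mulfI om_neq0); rewrite mulVKf//; rewrite -W /fp /fq; ring.
have wle t L : 0 <= t < 1 -> l1norm (fq t) <= L ->
  l1norm (w t 0 0) <= l1norm om^-1 * (K * L + K * A) /\
  l1norm (w t 1 0) <= l1norm om^-1 * (K * L + K * A).
  move=> t01 fqL; have [K1 K2 K3 K4] := HK t (HKo _ t01).
  have H a b : l1norm a <= K -> l1norm b <= K ->
    l1norm (om^-1 * (a * fq t - b * fp t)) <= l1norm om^-1 * (K * L + K * A).
    move=> aK bK; apply: le_trans (l1normM _ _) _; rewrite ler_wpM2l ?l1norm_ge0//.
    apply: le_trans (l1normB _ _) _; apply: lerD.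
      by apply: le_trans (l1normM _ _) _; apply: ler_pM => //; exact: l1norm_ge0.
    apply: le_trans (l1normM _ _) _; apply: ler_pM => //; try exact: l1norm_ge0.
    exact: fpA.
  by have [-> ->] := wE t t01; split; exact: H.
(* [w] is bounded, so that the boundary condition at 1, stated with [q 1], may
   be read along [q s]. *)
pose B := l1norm om^-1 * (K * (l1norm (fq 0) + A) + K * A).
have A0 : 0 <= A by rewrite /A !mulr_ge0// tmass_ge0.
have B0 : 0 <= B.
  rewrite /B; apply: mulr_ge0; first exact: l1norm_ge0.
  by apply: addr_ge0; apply: mulr_ge0 => //; apply: addr_ge0 => //; exact: l1norm_ge0.
have wB t : 0 <= t < 1 -> l1norm (w t 0 0) <= B /\ l1norm (w t 1 0) <= B.
  move=> t01; apply: wle => //; rewrite fqE//; apply: le_trans (l1normD _ _) _.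
  by rewrite lerD2l.
(* Between any two points [fq] varies by at most [2 * A], and [fq s] tends to 0 as [s] tends to 1.
   The bound [B], which depends on [fq 0], serves only to establish this limit and leaves no trace
   in the result. *)
have fq2A t : 0 <= t < 1 -> l1norm (fq t) <= 2 * A.
  move=> t01; apply/ler_addgt0Pr => e e0.
  have B1 : 0 < B + 1 by rewrite ltr_wpDl.
  have e2 : 0 < e / 2 by rewrite divr_gt0.
  have e1 : 0 < e / 2 / 2 / (B + 1) by rewrite !divr_gt0.
  have [d1 d10 H1] := cabs_cont_unif acq1 e1.
  have [d2 d20 H2] := cabs_cont_unif acq2 e1.
  have [d0 d00 H0] := bc _ e2.
  pose d := Num.min (Num.min d1 d2) (Num.min d0 1).
  have d_gt0 : 0 < d by rewrite /d !lt_min d10 d20 d00 ltr01.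
  pose s := 1 - d / 2.
  have sE : 1 - s = d / 2 by rewrite /s opprB addrC subrK.
  have ds : d / 2 < d by rewrite ltr_pdivrMr// ltr_pMr// ltr1n.
  have s_lt1 : s < 1 by rewrite -subr_gt0 sE divr_gt0.
  have [sd1 sd2 sd0 sd] : [/\ d / 2 < d1, d / 2 < d2, d / 2 < d0 & d / 2 < 1].
    by move: ds; rewrite {2}/d !lt_min => /andP[/andP[-> ->] /andP[-> ->]].
  have s01 : 0 <= s < 1 by rewrite s_lt1 andbT /s subr_ge0 ltW.
  have one01 : 0 <= (1 : R) <= 1 by rewrite ler01 lexx.
  have s1 : `|s - 1| = d / 2 by rewrite distrC sE gtr0_norm// divr_gt0.
  have {}H0 : l1norm (u%:C%C * w s 1 0 - w s 0 0) < e / 2.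
    by apply: H0; rewrite s_lt1 andbT /s ltrD2l ltrN2.
  have X1 : l1norm (q1 s - q1 1) <= e / 2 / 2 / (B + 1).
    by rewrite ltW// (H1 _ _ (HKo _ s01) one01)// s1.
  have X2 : l1norm (q2 s - q2 1) <= e / 2 / 2 / (B + 1).
    by rewrite ltW// (H2 _ _ (HKo _ s01) one01)// s1.
  have fqs : l1norm (fq s) <= e.
    have -> : fq s = (u%:C%C * w s 1 0 - w s 0 0) +
        (w s 1 0 * (q1 s - q1 1) - w s 0 0 * (q2 s - q2 1)).
      by rewrite /fq q11 q21; ring.
    have [wB0 wB1] := wB s s01.
    rewrite (splitr e); apply: le_trans (l1normD _ _) _; apply: lerD; first exact: ltW.
    have Q c c' : l1norm c <= B -> l1norm c' <= e / 2 / 2 / (B + 1) ->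
      l1norm (c * c') <= e / 2 / 2.
      move=> cB cE; apply: le_trans (l1normM _ _) _.
      apply: le_trans (ler_pM (l1norm_ge0 _) (l1norm_ge0 _) cB cE) _.
      rewrite mulrCA ler_piMr ?divr_ge0 ?ltW// ltr_pdivrMr// mul1r ltrDl//.
    apply: le_trans (l1normB _ _) _; rewrite [leRHS](splitr (e / 2)).
    by apply: lerD; exact: Q.
  have -> : fq t = fq s + (cprimitive (src q1 q2 k) t - cprimitive (src q1 q2 k) s).
    by rewrite (fqE t)// (fqE s)//; ring.
  apply: le_trans (l1normD _ _) _; rewrite [leRHS]addrC; apply: lerD => //.
  by apply: le_trans (l1normB _ _) _; rewrite mulr_natl mulr2n; exact: lerD.
move=> t t01; have [w0A w1A] := wle t _ t01 (fq2A t t01).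
rewrite /mass; apply: le_trans (lerD w0A w1A) _; rewrite /A.
by rewrite le_eqVlt; apply/orP; left; apply/eqP; ring.
Qed.

Lemma resolvent_injective w :
  DirC_shift X Y None (Some u) z w (fun=> 0) -> ae_eq01 w (fun=> 0).
Proof.
move=> sw; have [C C0 H] := resolvent_apriori; apply/aeW => t t01.
have m0 : tmass (fun=> 0) = 0.
  rewrite /tmass /mass (_ : (fun t => _) = cst 0); last first.
    by apply/funext => s; rewrite !mxE !l1norm0 addr0.
  by rewrite /Rintegral integral0.
have := H w _ sw t t01; rewrite m0 mulr0 => mw.
have w1 : l1norm (w t 0 0) <= 0 by apply: le_trans mw; rewrite lerDl l1norm_ge0.
have w2 : l1norm (w t 1 0) <= 0 by apply: le_trans mw; rewrite lerDr l1norm_ge0.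
apply/matrixP => i j; rewrite ord1 mxE; move: i.
by apply: ord2P; exact: l1norm_eq0.
Qed.

Lemma resolvent_bounded : exists2 M : R, 0 <= M & forall w k,
  DirC_shift X Y None (Some u) z w k -> (sqnormC X Y w <= M%:E * sqnormC X Y k)%E.
Proof.
have [C C0 H] := resolvent_apriori; have T0 := T_ge0.
(* The factors come from [sqnorm_ub], from the pointwise bound used once for each of the real and
   imaginary parts, and from [tmass_sq]. *)
exists (T * (2 * C ^+ 2) * (16 * T)); first by rewrite !mulr_ge0// sqr_ge0.
move=> w k sw; have [hk [h [[_ mR _ _ _] [_ mI' _ _ _]] _]] := sw.
have ptw t : 0 <= t < 1 -> sqsum (re_part w) t + sqsum (im_part w) t <= (C * tmass k) ^+ 2.
  move=> t01; apply: le_trans (sqsum_mass _ _) _.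
  by apply: lerXn2r (H _ _ sw _ t01); rewrite nnegrE ?mass_ge0// mulr_ge0// tmass_ge0.
have sqle v : mcomp v -> (forall t, 0 <= t < 1 -> sqsum v t <= (C * tmass k) ^+ 2) ->
  (sqnorm X Y v <= (T * (C ^+ 2 * tmass k ^+ 2))%:E)%E.
  move=> mv bv; apply: le_trans (sqnorm_ub mv) _; rewrite EFinM lee_wpmul2l ?lee_fin//.
  rewrite -exprMn; apply: (@le_trans _ _ (\int[mu]_(t in I01) ((C * tmass k) ^+ 2)%:E)%E).
    apply: ge0_le_integral => //.
    - by move=> t _; rewrite lee_fin sqsum_ge0.
    - by apply/measurable_EFinP; exact: measurable_sqsum.
  by rewrite integral_cst// [X in (_ * X <= _)%E]muI01 mule1.
have leR t : 0 <= t < 1 -> sqsum (re_part w) t <= (C * tmass k) ^+ 2.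
  by move=> /ptw; apply: le_trans; rewrite lerDl sqsum_ge0.
have leI t : 0 <= t < 1 -> sqsum (im_part w) t <= (C * tmass k) ^+ 2.
  by move=> /ptw; apply: le_trans; rewrite lerDr sqsum_ge0.
have := sqle _ mR.1 leR; have := sqle _ mI'.1 leI; have := tmass_sq hk.
have [[_ fR] [_ fI]] := hk.
have := sqnorm_ge0 (re_part k); have := sqnorm_ge0 (im_part k).
rewrite /sqnormC; case: (sqnorm X Y (re_part k)) fR => [r _| |]//.
case: (sqnorm X Y (im_part k)) fI => [r' _| |]// _ _ H1 H2 H3.
apply: le_trans (leeD H3 H2) _; move: H1; rewrite -EFinD -EFinM -EFinD ![(_ <= _)%E]lee_fin.
move=> H1; apply: (@le_trans _ _ (T * (2 * C ^+ 2) * (16 * T * (r + r')))).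
  rewrite [leLHS](_ : _ = T * (2 * C ^+ 2) * tmass k ^+ 2); last by ring.
  by rewrite ler_wpM2l// !mulr_ge0// sqr_ge0.
by rewrite le_eqVlt; apply/orP; left; apply/eqP; ring.
Qed.

Lemma resolvent_surjective k : in_L2C X Y k ->
  exists w, DirC_shift X Y None (Some u) z w k.
Proof.
move=> hk; have [K K0 HK] := solutions_bounded.
have HKo t : 0 <= t < 1 -> 0 <= t <= 1 by move=> /andP[-> /ltW].
have intp : cintegrable (src p1 p2 k).
  apply: (cintegrable_mass (k := k) (K := 2 * K * T) hk (src_cmeas hk acp1 acp2) _).1.
  by move=> t t01; have [] := HK t (HKo _ t01) => *; exact: src_bound.
have intq : cintegrable (src q1 q2 k).
  apply: (cintegrable_mass (k := k) (K := 2 * K * T) hk (src_cmeas hk acq1 acq2) _).1.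
  by move=> t t01; have [] := HK t (HKo _ t01) => *; exact: src_bound.
(* Variation of constants: [gp] vanishes at 0 and [gq] at 1, which makes [w] a multiple of [p] at 0
   and of [q] at 1, as the two boundary conditions require. *)
pose gp := cprimitive (src p1 p2 k).
pose gq t := cprimitive (src q1 q2 k) t - cprimitive (src q1 q2 k) 1.
pose f (a b : R -> R[i]) t := om^-1 * (a t * gq t - b t * gp t).
pose w t : 'cV[R[i]]_2 := \col_i (if i == 0 then f p1 q1 t else f p2 q2 t).
have w1E : (fun t => w t 0 0) = f p1 q1 by apply/funext => t; rewrite mxE.
have w2E : (fun t => w t 1 0) = f p2 q2 by apply/funext => t; rewrite mxE.
have acgp : cabs_cont gp 0 1 by exact: cprimitive_abs_cont.
have acgq : cabs_cont gq 0 1.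
  exact: (cabs_contD (cprimitive_abs_cont 1 intq) (cabs_cont_cst _ _ _)).
have acf a b : cabs_cont a 0 1 -> cabs_cont b 0 1 -> cabs_cont (f a b) 0 1.
  move=> aca acb; apply: (cabs_contZ _ ler01).
  have := cabs_contD (cabs_contM ler01 aca acgq)
    (cabs_contZ (-1) ler01 (cabs_contM ler01 acb acgp)).
  by congr cabs_cont; apply/funext => s; rewrite mulN1r.
exists w; apply: DirC_shift_intro => //.
- by apply: ord2P; rewrite ?w1E ?w2E; exact: acf.
- rewrite w1E w2E.
  have der := ae_and2 (ae_and2 sysp sysq)
    (ae_and2 (cprimitive_derive intp) (cprimitive_derive intq)).
  apply: ae_impl der => t [[Hp Hq] [Hgp Hgq]] t01.
  have [dp1 dp2] := Hp t01; have [dq1 dq2] := Hq t01.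
  have dgp : cderive gp t _ := Hgp t01.
  have dgq : cderive gq t _ := cderiveD (Hgq t01) (cderive_cst (- cprimitive (src q1 q2 k) 1) t).
  have W : p2 t * q1 t - p1 t * q2 t = om.
    by apply: wronskE; case/andP: t01 => /ltW -> /ltW ->.
  have df a b a' b' : cderive a t a' -> cderive b t b' ->
    cderive (f a b) t (om^-1 * (a' * gq t - b' * gp t) +
      om^-1 * (a t * src q1 q2 k t - b t * src p1 p2 k t)).
    move=> da db.
    have := cderiveZ om^-1 (cderiveD (cderiveM da dgq) (cderiveZ (-1) (cderiveM db dgp))).
    set F := (fun s => _ * _); rewrite (_ : F = f a b).
      by move=> H1; apply: cderive_eq H1 _; ring.
    by apply/funext => s; rewrite /F mulN1r.
  split.
  + apply: cderive_eq (df _ _ _ _ dp1 dq1) _.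
    have -> : p1 t * src q1 q2 k t - q1 t * src p1 p2 k t =
      om * ((r12 t)%:C%C * k t 0 0 + (r22 t)%:C%C * k t 1 0) by rewrite -W /src; ring.
    by rewrite mulKf// /f /tau1; ring.
  + apply: cderive_eq (df _ _ _ _ dp2 dq2) _.
    have -> : p2 t * src q1 q2 k t - q2 t * src p1 p2 k t =
      om * - ((r11 t)%:C%C * k t 0 0 + (r12 t)%:C%C * k t 1 0) by rewrite -W /src; ring.
    by rewrite mulKf// /f /tau2; ring.
- by rewrite mxE /= /f p20 /gp cprimitive0 mul0r mulr0 subrr mulr0.
- by rewrite !mxE /= /f /gq subrr q11 q21; ring.
Qed.

Lemma in_resolvent_set_wronskian : in_resolvent_set X Y None (Some u) z.
Proof.
split; [exact: resolvent_injective|exact: resolvent_surjective|exact: resolvent_bounded].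
Qed.

End resolvent.

Lemma not_in_resolvent_set (u : R) (z : R[i]) (p1 p2 : R -> R[i]) :
  cabs_cont p1 0 1 -> cabs_cont p2 0 1 ->
  dirac_system z p1 p2 (fun=> 0) (fun=> 0) ->
  (forall t, 0 <= t < 1 -> p1 t = 0 -> p2 t = 0 -> False) ->
  p2 0 = 0 -> u%:C%C * p2 1 = p1 1 ->
  ~ in_resolvent_set X Y None (Some u) z.
Proof.
move=> ac1 ac2 sys nz p20 bc [inj _ _].
pose w t : 'cV[R[i]]_2 := \col_i (if i == 0 then p1 t else p2 t).
have w1E : (fun t => w t 0 0) = p1 by apply/funext => t; rewrite mxE.
have w2E : (fun t => w t 1 0) = p2 by apply/funext => t; rewrite mxE.
have L20 : in_L2 X Y (fun=> 0).
  apply: (@in_L2_bounded _ 0).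
    move=> i; rewrite (_ : (fun t => _) = cst 0); first exact: measurable_cst.
    by apply/funext => t; rewrite mxE.
  by move=> t i _; rewrite mxE normr0.
have /inj [N [mN N0 sub]] : DirC_shift X Y None (Some u) z w (fun=> 0).
  apply: DirC_shift_intro.
  - have E0 (p : R[i] -> R) : p 0 = 0 ->
      (fun _ : R => map_mx p (0 : 'cV[R[i]]_2)) = (fun=> 0).
      by move=> p0; apply/funext => t; apply/matrixP => i j; rewrite !mxE.
    by split; rewrite /re_part /im_part E0.
  - by apply: ord2P; rewrite ?w1E ?w2E.
  - rewrite w1E w2E; apply: ae_impl sys => t H /H.
    by rewrite !mxE.
  - by rewrite mxE.
  - by rewrite !mxE.
(* As [w] vanishes nowhere, the exceptional null set would contain all of [0, 1). *)
have : (mu I01 <= mu N)%E.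
  apply: le_measure; rewrite ?inE// => t; rewrite /= in_itv/= => t01; apply: sub => /= H.
  have := H t01 => /matrixP E; apply: (nz _ t01).
    by have := E 0 0; rewrite !mxE.
  by have := E 1 0; rewrite !mxE.
by rewrite [X in (_ <= X)%E]N0 [X in (X <= _)%E]muI01 lee_fin ler10.
Qed.

End dirac_operator.

(** * Step weights and transfer matrices *)

Section step_weight.
Context (R : realType).
Notation mu := (@lebesgue_measure R).
Local Notation I01 := (`[(0 : R), 1[%classic).
Variable n : nat.
Local Notation N := n.+1.

Lemma truncn_step (k : nat) (t : R) : 0 <= t ->
  (Num.truncn (N%:R * t) == k) = (k%:R / N%:R <= t < k.+1%:R / N%:R).
Proof.
move=> t0; rewrite truncn_eq ?mulr_ge0//.
by rewrite ler_pdivrMr ?ltr0Sn// ltr_pdivlMr ?ltr0Sn// (mulrC N%:R).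
Qed.

Lemma truncn_lt (t : R) : 0 <= t < 1 -> (Num.truncn (N%:R * t) < N)%N.
Proof.
move=> /andP[t0 t1]; rewrite truncn_lt_nat ?mulr_ge0//.
by rewrite gtr_pMr ?ltr0Sn.
Qed.

Lemma measurable_step (f : nat -> R) :
  measurable_fun I01 (fun t => f (Num.truncn (N%:R * t))).
Proof.
pose F (t : R) : R := \sum_(k < N) f k * \1_(`[k%:R / N%:R, k.+1%:R / N%:R[%classic) t.
have mF : measurable_fun I01 F.
  apply: measurable_sum => k; apply: measurable_funM; first exact: measurable_cst.
  exact: measurable_indic.
apply: eq_measurable_fun mF => t; rewrite inE /= in_itv/= => t01.
have /andP[t0 t1] := t01; pose k0 := Ordinal (truncn_lt t01).
rewrite /F (bigD1 k0)//= big1 ?addr0.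
  rewrite indicE mem_set ?mulr1//= in_itv/=.
  by rewrite -truncn_step.
move=> k kk0; rewrite indicE memNset ?mulr0//= in_itv/= -truncn_step//.
by move=> /eqP H; move/eqP: kk0; apply; apply/val_inj; rewrite /= H.
Qed.

Lemma ae_step_interior : {ae mu, forall t : R, 0 < t < 1 ->
  exists2 k, (k < N)%N & k%:R / N%:R < t < k.+1%:R / N%:R}.
Proof.
pose Z := \bigcup_k [set (k%:R / N%:R : R)].
exists Z; split.
- by apply: bigcupT_measurable => k; exact: measurable_set1.
- by apply: countable_lebesgue_measure0; apply: bigcup_countable.
move=> t /= H; apply: contrapT => H'; apply: H => /andP[t0 t1].
have t01 : 0 <= t < 1 by rewrite (ltW t0).
exists (Num.truncn (N%:R * t)); first exact: truncn_lt.
have := truncn_step (Num.truncn (N%:R * t)) (ltW t0); rewrite eqxx => /esym/andP[H1 H2].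
rewrite H2 andbT lt_neqAle H1 andbT; apply/eqP => H3; apply: H'.
by exists (Num.truncn (N%:R * t)); last exact/esym.
Qed.

End step_weight.

(** * Solutions as products of transfer matrices *)

Section transfer.
Context (R : realType).
Local Notation Re := (@complex.Re R).
Local Notation Im := (@complex.Im R).
Notation mu := (@lebesgue_measure R).
Local Notation I01 := (`[(0 : R), 1[%classic).
Variables (n : nat) (xs ys : nat -> R) (z : R[i]).
Local Notation N := n.+1.
Hypothesis ys_gt0 : forall k, (k < N)%N -> 0 < ys k.

Let w11 k : R := (2 * ys k)^-1.
Let w12 k : R := (2 * ys k)^-1 * - xs k.
Let w22 k : R := (2 * ys k)^-1 * (xs k ^+ 2 + ys k ^+ 2).
Let X := step_path N xs.
Let Y := step_path N ys.
Let I : R[i] := (0 +i* 1)%C.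

Let II : I * I = -1.
Proof.
by apply: complexP;
  rewrite /= !(mul0r,mul1r,mulr0) ?subr0 ?add0r ?addr0 ?sub0r ?oppr0.
Qed.

Let weight11 t : weight X Y t 0 0 = w11 (Num.truncn (N%:R * t)).
Proof. by rewrite !mxE /= mulr1. Qed.
Let weight12 t : weight X Y t 0 1 = w12 (Num.truncn (N%:R * t)).
Proof. by rewrite !mxE. Qed.
Let weight22 t : weight X Y t 1 1 = w22 (Num.truncn (N%:R * t)).
Proof. by rewrite !mxE. Qed.

Let Y_gt0 t : 0 <= t < 1 -> 0 < Y t.
Proof. by move=> /truncn_lt -/(_ n) H; exact: ys_gt0. Qed.

Let detW k : (k < N)%N -> (w11 k)%:C%C * (w22 k)%:C%C - (w12 k)%:C%C ^+ 2 = 4^-1 :> R[i].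
Proof.
move=> /ys_gt0/gt_eqF/negbT yk; rewrite -rmorphM -rmorphXn -rmorphB /=.
have -> : w11 k * w22 k - w12 k ^+ 2 = 4^-1 by rewrite /w11 /w12 /w22; field; rewrite yk.
by rewrite fmorphV /= rmorph_nat.
Qed.

(** The eigenvalues [exp(i z s / 2)] and [exp(- i z s / 2)] of the transfer matrix, whose exponent
    [- s z J W_k] has trace 0 and determinant [(s z)^2 / 4]. *)
Let ep s : R[i] := cexp (I * z / 2) s.
Let em s : R[i] := cexp (- (I * z / 2)) s.

Let epem s : ep s * em s = 1. Proof. exact: cexpN. Qed.

(* Components of exp(- s z J W_k) (a, b), computed from (J W_k)^2 = - 1/4. *)
Let E1 k s (a b : R[i]) : R[i] :=
  (ep s + em s) / 2 * a + I * (ep s - em s) * (- (w12 k)%:C%C * a - (w22 k)%:C%C * b).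
Let E2 k s (a b : R[i]) : R[i] :=
  (ep s + em s) / 2 * b + I * (ep s - em s) * ((w11 k)%:C%C * a + (w12 k)%:C%C * b).

Let E10 k a b : E1 k 0 a b = a.
Proof. by rewrite /E1 /ep /em !cexp0 subrr mulr0 mul0r addr0; field. Qed.

Let E20 k a b : E2 k 0 a b = b.
Proof. by rewrite /E2 /ep /em !cexp0 subrr mulr0 mul0r addr0; field. Qed.

(** The transfer matrix has determinant 1, its exponent being trace-free; in this form it comes down
    to [ep s * em s = 1] and det W = 1/4. *)
Let E_wronskian k s a b a' b' : (k < N)%N ->
  E2 k s a b * E1 k s a' b' - E1 k s a b * E2 k s a' b' = b * a' - a * b'.
Proof.
move=> kN; rewrite /E1 /E2.
have -> : b * a' - a * b' = (ep s * em s) * (b * a' - a * b') by rewrite epem mul1r.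
transitivity (((ep s + em s) ^+ 2 / 4 + (I * I) * (ep s - em s) ^+ 2 *
  ((w11 k)%:C%C * (w22 k)%:C%C - (w12 k)%:C%C ^+ 2)) * (b * a' - a * b')).
  by field.
by rewrite II detW//; field.
Qed.

Let shift_derive (c : R[i]) a t : cderive (fun s => cexp c (s - a)) t (c * cexp c (t - a)).
Proof.
have := cderiveM (cexp_derive c t) (cderive_cst (cexp c (- a)) t).
rewrite mulr0 addr0 -mulrA -cexp_add.
by rewrite (_ : (fun s => _) = (fun s => cexp c (s - a)))//; apply/funext => s; rewrite cexp_add.
Qed.

Let E_derive k d a b t : (k < N)%N ->
  let p s := E1 k (s - d) a b in let q s := E2 k (s - d) a b in
  cderive p t ((w12 k)%:C%C * (z * p t) + (w22 k)%:C%C * (z * q t)) /\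
  cderive q t (- ((w11 k)%:C%C * (z * p t) + (w12 k)%:C%C * (z * q t))).
Proof.
move=> kN p q; have D := detW kN.
have dp : cderive (fun s => ep (s - d)) t ((I * z / 2) * ep (t - d)) by exact: shift_derive.
have dm : cderive (fun s => em (s - d)) t (- (I * z / 2) * em (t - d)) by exact: shift_derive.
have gen B C :
  cderive (fun s => (ep (s - d) + em (s - d)) / 2 * C + I * (ep (s - d) - em (s - d)) * B) t
   (I * z / 4 * (ep (t - d) - em (t - d)) * C + (I * I) * (z / 2) * (ep (t - d) + em (t - d)) * B).
  have := cderiveD (cderiveZ (C / 2) (cderiveD dp dm))
                   (cderiveZ (I * B) (cderiveD dp (cderiveZ (-1) dm))).
  set F := (fun s => _); rewrite (_ : F = fun s =>
    (ep (s - d) + em (s - d)) / 2 * C + I * (ep (s - d) - em (s - d)) * B).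
    by move=> H; apply: cderive_eq H _; field.
  by apply/funext => s; rewrite /F; field.
split.
- apply: cderive_eq (gen _ a) _; rewrite II /p /q /E1 /E2.
  transitivity (z * I * (ep (t - d) - em (t - d)) * a * 4^-1 + z / 2 * (ep (t - d) + em (t - d)) *
    ((w12 k)%:C%C * a + (w22 k)%:C%C * b)); first by field.
  by rewrite -D; field.
- apply: cderive_eq (gen _ b) _; rewrite II /p /q /E1 /E2.
  transitivity (z * I * (ep (t - d) - em (t - d)) * b * 4^-1 - z / 2 * (ep (t - d) + em (t - d)) *
    ((w11 k)%:C%C * a + (w12 k)%:C%C * b)); first by field.
  by rewrite -D; field.
Qed.

Let node k : R := k%:R / N%:R.
Let step : R := N%:R^-1.

Let step01 : 0 <= step <= 1.
Proof. by rewrite /step invr_ge0 ler0n /= invf_le1 ?ltr0Sn// ler1n. Qed.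

Let nodeS k : node k.+1 = node k + step.
Proof. by rewrite /node -addn1 natrD mulrDl mul1r. Qed.

Let node_le j k : (j <= k)%N -> node j <= node k.
Proof. by move=> jk; rewrite /node ler_wpM2r ?invr_ge0// ler_nat. Qed.

(** Each factor is the identity before its step and constant after it. Absolute continuity,
    linearity and conservation of the Wronskian thus become inductions on the number of factors,
    with no gluing at the nodes. *)
Fixpoint sol (m : nat) (v : R[i] * R[i]) (t : R) : R[i] * R[i] :=
  if m is k.+1 then
    let p := sol k v t in let s := clamp (node k) step t in
    (E1 k s p.1 p.2, E2 k s p.1 p.2)
  else v.

(* The values of [sol m v] to the right of the m-th node. *)
Fixpoint disc (m : nat) (v : R[i] * R[i]) : R[i] * R[i] :=
  if m is k.+1 then
    let p := disc k v in (E1 k step p.1 p.2, E2 k step p.1 p.2)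
  else v.

Let sol_lo m j v t : t <= node m -> sol (m + j) v t = sol m v t.
Proof.
move=> tm; elim: j => [|j IH]; first by rewrite addn0.
have tmj : t <= node (m + j) by apply: le_trans tm (node_le _); rewrite leq_addr.
rewrite addnS /= clamp_lo//; last by case/andP: step01.
by rewrite E10 E20 -surjective_pairing.
Qed.

Let sol_hi m v t : node m <= t -> sol m v t = disc m v.
Proof.
elim: m => [//|m IH] mt /=; rewrite clamp_hi; last 2 first.
- by case/andP: step01.
- by rewrite -nodeS.
by rewrite IH// (le_trans (node_le (leqnSn m))).
Qed.

Let sol_abs_cont m v :
  cabs_cont (fun t => (sol m v t).1) 0 1 /\ cabs_cont (fun t => (sol m v t).2) 0 1.
Proof.
elim: m => [|m [IH1 IH2]] /=; first by split; exact: cabs_cont_cst.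
have acp : cabs_cont (fun t => ep (clamp (node m) step t)) 0 1 by exact: cexp_clamp_abs_cont.
have acm : cabs_cont (fun t => em (clamp (node m) step t)) 0 1 by exact: cexp_clamp_abs_cont.
have H (a b : R -> R[i]) : cabs_cont a 0 1 -> cabs_cont b 0 1 -> cabs_cont
  (fun t => (ep (clamp (node m) step t) + em (clamp (node m) step t)) / 2 * a t +
    I * (ep (clamp (node m) step t) - em (clamp (node m) step t)) * b t) 0 1.
  move=> aca acb; have l01 := @ler01 R.
  have := cabs_contD (cabs_contM l01 (cabs_contZ 2^-1 l01 (cabs_contD acp acm)) aca)
    (cabs_contM l01 (cabs_contZ I l01 (cabs_contD acp (cabs_contZ (-1) l01 acm))) acb).
  by congr cabs_cont; apply/funext => t; rewrite mulN1r (mulrC _ 2^-1).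
have l01 := @ler01 R.
split; apply: H => //.
- have := cabs_contD (cabs_contZ (- (w12 m)%:C%C) l01 IH1) (cabs_contZ (- (w22 m)%:C%C) l01 IH2).
  by congr cabs_cont; apply/funext => t; rewrite !mulNr.
- exact: cabs_contD (cabs_contZ _ l01 IH1) (cabs_contZ _ l01 IH2).
Qed.

Let sol_wronskian m v v' t : (m <= N)%N ->
  (sol m v t).2 * (sol m v' t).1 - (sol m v t).1 * (sol m v' t).2 = v.2 * v'.1 - v.1 * v'.2.
Proof. by elim: m => [//|m IH] mN /=; rewrite E_wronskian// IH// ltnW. Qed.

Let sol_linear m (a b : R[i]) v v' t :
  let s := sol m (a * v.1 + b * v'.1, a * v.2 + b * v'.2) t in
  s.1 = a * (sol m v t).1 + b * (sol m v' t).1 /\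
  s.2 = a * (sol m v t).2 + b * (sol m v' t).2.
Proof. by elim: m => [//|m [IH1 IH2]] /=; rewrite IH1 IH2; split; rewrite /E1 /E2; ring. Qed.

Let node0 : node 0 = 0. Proof. by rewrite /node mul0r. Qed.
Let nodeN : node N = 1. Proof. by rewrite /node divff// pnatr_eq0. Qed.

Let sol_0 v : sol N v 0 = v.
Proof. by rewrite -(add0n N) sol_lo// node0. Qed.

Let sol_1 v : sol N v 1 = disc N v.
Proof. by rewrite sol_hi// nodeN. Qed.

Let sol_system v :
  dirac_system X Y z (fun t => (sol N v t).1) (fun t => (sol N v t).2) (fun=> 0) (fun=> 0).
Proof.
apply: ae_impl (ae_step_interior R n) => t H t01; have [k kN /andP[kt tk]] := H t01.
have nearE : \forall s \near t, sol N v s =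
    (E1 k (s - node k) (disc k v).1 (disc k v).2, E2 k (s - node k) (disc k v).1 (disc k v).2).
  have : \forall s \near t, s \in `]node k, node k.+1[.
    by apply: near_in_itvoo; rewrite in_itv/= kt tk.
  apply: filterS => s /itvP si.
  have ks : node k < s by rewrite si.
  have sk : s < node k.+1 by rewrite si.
  have -> : sol N v s = sol (k.+1 + (N - k.+1)) v s by rewrite subnKC.
  rewrite (sol_lo _ _ (ltW sk)) /= (sol_hi _ (ltW ks)).
  by rewrite (clamp_mid (ltW ks)) // -nodeS ltW.
have tE := nbhs_singleton nearE.
have trE : Num.truncn (N%:R * t) = k.
  by apply/eqP; rewrite truncn_step ?(ltW tk) ?(ltW kt) ?tk//; case/andP: t01 => /ltW.
have [d1 d2] := E_derive (node k) (disc k v).1 (disc k v).2 t kN.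
have near1 : \forall s \near t,
    E1 k (s - node k) (disc k v).1 (disc k v).2 = (sol N v s).1.
  by apply: filterS nearE => s ->.
have near2 : \forall s \near t,
    E2 k (s - node k) (disc k v).1 (disc k v).2 = (sol N v s).2.
  by apply: filterS nearE => s ->.
split.
- by apply: cderive_eq (cderive_near near1 d1) _; rewrite weight12 weight22 trE tE !addr0.
- by apply: cderive_eq (cderive_near near2 d2) _; rewrite weight11 weight12 trE tE !addr0.
Qed.

Let mweight11 : measurable_fun I01 (fun t => weight X Y t 0 0).
Proof. by rewrite (funext weight11); exact: measurable_step. Qed.
Let mweight12 : measurable_fun I01 (fun t => weight X Y t 0 1).
Proof. by rewrite (funext weight12); exact: measurable_step. Qed.
Let mweight22 : measurable_fun I01 (fun t => weight X Y t 1 1).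
Proof. by rewrite (funext weight22); exact: measurable_step. Qed.

(** The sum over all steps is a crude uniform bound, valid because every term is nonnegative for
    [ys k > 0]. *)
Let trace_bound t : 0 <= t < 1 ->
  weight X Y t 0 0 + weight X Y t 1 1 <= \sum_(k < N) (w11 k + w22 k).
Proof.
move=> t01; rewrite weight11 weight22 (bigD1 (Ordinal (truncn_lt n t01)))//= lerDl.
apply: sumr_ge0 => k _; have yk := ys_gt0 (ltn_ord k).
have y2 : 0 <= (2 * ys k)^-1 by rewrite invr_ge0 mulr_ge0// ltW.
by rewrite addr_ge0// mulr_ge0// addr_ge0// sqr_ge0.
Qed.

(* v^T J (x_N, 1)^T for v the value at 1 of the solution starting from (1, 0). *)
Definition shooting : R[i] := (xs N)%:C%C * (disc N (1, 0)).2 - (disc N (1, 0)).1.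

Lemma in_resolvent_set_shooting :
  in_resolvent_set X Y None (Some (xs N)) z <-> shooting != 0.
Proof.
pose phi := sol N (1, 0).
have [ac1 ac2] := sol_abs_cont N (1, 0).
split=> [H|D0]; last first.
  (* Let phi and psi start from (1, 0) and (0, 1), and let [l] be the functional
     [v |-> x_N v_2 - v_1] at 1. The solution [l(psi) phi - l(phi) psi] is annihilated by [l]. As
     phi and psi have Wronskian -1, its value at 1 is exactly [(x_N, 1)], and its Wronskian with phi
     is [shooting]. *)
  pose c2 := - shooting.
  pose c1 := (xs N)%:C%C * (disc N (0, 1)).2 - (disc N (0, 1)).1.
  pose v0 : R[i] * R[i] := (c1 * 1 + c2 * 0, c1 * 0 + c2 * 1).
  have [L1 L2] := sol_linear N c1 c2 (1, 0) (0, 1) 1.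
  have W := sol_wronskian (1, 0) (0, 1) 1 (leqnn N).
  have [aq1 aq2] := sol_abs_cont N v0.
  apply: (in_resolvent_set_wronskian Y_gt0 mweight11 mweight12 mweight22 trace_bound
    ac1 ac2 aq1 aq2 (sol_system _) (sol_system _) (om := shooting)) => //.
  - move=> t _; rewrite sol_wronskian// /v0 /c2 /=; ring.
  - by rewrite sol_0.
  - rewrite L1 !sol_1 /c1 /c2 /shooting; move: W; rewrite !sol_1.
    move: (disc N (1, 0)) (disc N (0, 1)) => d e /= W.
    transitivity ((d.2 * e.1 - d.1 * e.2) * - (xs N)%:C%C); first by ring.
    by rewrite W; ring.
  - rewrite L2 !sol_1 /c1 /c2 /shooting; move: W; rewrite !sol_1.
    move: (disc N (1, 0)) (disc N (0, 1)) => d e /= W.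
    transitivity (- (d.2 * e.1 - d.1 * e.2)); first by ring.
    by rewrite W; ring.
apply/eqP => D0.
apply: (not_in_resolvent_set Y_gt0 mweight11 mweight12 mweight22 trace_bound ac1 ac2
  (sol_system _) _ _ _ H) => //.
(* The Wronskian with the solution starting from (0, 1) is -1, so phi has no zero. *)
- move=> t _ p10 p20; have := sol_wronskian (1, 0) (0, 1) t (leqnn N).
  rewrite p10 p20 /= !mul0r subrr mulr1 sub0r => /eqP; rewrite eq_sym oppr_eq0.
  by rewrite oner_eq0.
- by rewrite sol_0.
- by rewrite !sol_1; apply/eqP; rewrite -subr_eq0; apply/eqP.
Qed.

(* With [p = x_k + i y_k] the covectors [(-1, p)] and [(-1, p^* )] are
   eigenvectors of the transfer matrix [exp(- s z J W_k)]. *)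
Let disc_phase k s a b : (k < N)%N ->
  E2 k s a b * ((xs k)%:C%C + I * (ys k)%:C%C) - E1 k s a b =
    ep s * (b * ((xs k)%:C%C + I * (ys k)%:C%C) - a) /\
  E2 k s a b * ((xs k)%:C%C - I * (ys k)%:C%C) - E1 k s a b =
    em s * (b * ((xs k)%:C%C - I * (ys k)%:C%C) - a).
Proof.
move=> kN; have yk : (ys k)%:C%C != 0 :> R[i] by rewrite fmorph_eq0 gt_eqF// ys_gt0.
have e11 : (w11 k)%:C%C = (2 * (ys k)%:C%C)^-1 :> R[i].
  by rewrite /w11 fmorphV /= rmorphM /= rmorph_nat.
have e12 : (w12 k)%:C%C = - (xs k)%:C%C * (2 * (ys k)%:C%C)^-1 :> R[i].
  by rewrite /w12 rmorphM /= -e11 rmorphN /= mulrC.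
have e22 : (w22 k)%:C%C =
    ((xs k)%:C%C ^+ 2 - (I * I) * (ys k)%:C%C ^+ 2) * (2 * (ys k)%:C%C)^-1 :> R[i].
  by rewrite /w22 rmorphM /= -e11 rmorphD /= !rmorphXn /= II mulN1r opprK mulrC.
rewrite /E1 /E2 e11 e12 e22; split.
- transitivity ((ep s + em s) / 2 * (b * ((xs k)%:C%C + I * (ys k)%:C%C) - a)
    - (I * I) * (ep s - em s) / 2 * (b * ((xs k)%:C%C + I * (ys k)%:C%C) - a)).
    by field; rewrite yk.
  by rewrite II; field.
- transitivity ((ep s + em s) / 2 * (b * ((xs k)%:C%C - I * (ys k)%:C%C) - a)
    + (I * I) * (ep s - em s) / 2 * (b * ((xs k)%:C%C - I * (ys k)%:C%C) - a)).
    by field; rewrite yk.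
  by rewrite II; field.
Qed.

(** Here [q] stands for [gamma / (1 - gamma)], so that [1 + q = 1 / (1 - gamma)]. On a step the two
    functionals are multiplied by [ep step] and [em step]; taking out the common factor [em step]
    leaves [ep step ^+ 2 = zeta] and 1, and the change of [p] at the node mixes them with the
    coefficients of the recursion for [a] and [b]. At N the functional is [shooting] because [p N]
    is real. *)
Lemma shooting_eq0 (q a b : nat -> R[i]) :
  xs 0 = 0 -> ys 0 = 1 -> ys N = 0 ->
  (forall k, (k < N)%N -> xs k.+1 = xs k + (- 2 * Im (q k)) * ys k) ->
  (forall k, (k < N)%N -> ys k.+1 = ys k * (1 + 2 * Re (q k))) ->
  a 0 = 1 -> b 0 = 1 ->
  (forall k, (k < N)%N -> a k.+1 = (1 + q k) * cexp (I * z) N%:R^-1 * a k - q k * b k) ->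
  (forall k, (k < N)%N ->
     b k.+1 = (1 + (q k)^*) * b k - (q k)^* * cexp (I * z) N%:R^-1 * a k) ->
  (shooting == 0) = (a N == 0).
Proof.
move=> x0 y0 yN xS yS a0 b0 aS bS.
have zeta : cexp (I * z) N%:R^-1 = ep step * ep step.
  by rewrite {1}(splitr (I * z)) cexpD.
pose p k := (xs k)%:C%C + I * (ys k)%:C%C; pose pb k := (xs k)%:C%C - I * (ys k)%:C%C.
have C2 : (2 : R)%:C%C = 2 :> R[i] by rewrite rmorph_nat.
have ReE (c : R[i]) : c = (Re c)%:C%C + I * (Im c)%:C%C.
  by apply: complexP; rewrite !(ReD, ImD, ReM, ImM) /=; ring.
have cE (c : R[i]) : c^* = (Re c)%:C%C - I * (Im c)%:C%C.
  by case: c => r s; apply: complexP; rewrite !(ReD, ImD, ReM, ImM) /=; ring.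
have pS k : (k < N)%N -> p k.+1 = (1 + q k) * p k - q k * pb k.
  move=> kN; rewrite /p /pb xS// yS// {3 4}(ReE (q k)).
  rewrite !(rmorphD, rmorphM, rmorphN, rmorph1, C2) /=.
  transitivity ((xs k)%:C%C + I * (ys k)%:C%C * (1 + 2 * (Re (q k))%:C%C)
     + (I * I) * 2 * (Im (q k))%:C%C * (ys k)%:C%C); first by rewrite II; ring.
  by ring.
have pbS k : (k < N)%N -> pb k.+1 = (1 + (q k)^*) * pb k - (q k)^* * p k.
  move=> kN; rewrite /p /pb xS// yS// (cE (q k)).
  rewrite !(rmorphD, rmorphM, rmorphN, rmorph1, C2) /=.
  transitivity ((xs k)%:C%C - I * (ys k)%:C%C * (1 + 2 * (Re (q k))%:C%C)
     + (I * I) * 2 * (Im (q k))%:C%C * (ys k)%:C%C); first by rewrite II; ring.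
  by ring.
have main m : (m <= N)%N ->
  (disc m (1, 0)).2 * p m - (disc m (1, 0)).1 = - em step ^+ m * a m /\
  (disc m (1, 0)).2 * pb m - (disc m (1, 0)).1 = - em step ^+ m * b m.
  elim: m => [_|m IH mN].
    by rewrite /= a0 b0 expr0 !mul0r !sub0r !mulr1.
  have [IH1 IH2] := IH (ltnW mN); rewrite pS// pbS// aS// bS// zeta.
  have [] := disc_phase step (disc m (1, 0)).1 (disc m (1, 0)).2 mN.
  rewrite -/(p m) -/(pb m) IH1 IH2 /=.
  move: (E1 _ _ _ _) (E2 _ _ _ _) => e1 e2 P1 P2.
  have em2 c : em step ^+ m.+1 * (ep step * ep step * c) = em step ^+ m * ep step * c.
    rewrite exprS; transitivity (em step ^+ m * (ep step * em step) * ep step * c); first by ring.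
    by rewrite epem mulr1.
  split.
  - transitivity ((1 + q m) * (e2 * p m - e1) - q m * (e2 * pb m - e1)); first by ring.
    rewrite P1 P2; transitivity (-
      ((1 + q m) * (em step ^+ m * ep step * a m) - q m * (em step ^+ m.+1 * b m))).
      by rewrite exprS; ring.
    by rewrite -em2; ring.
  - transitivity ((1 + (q m)^*) * (e2 * pb m - e1) - (q m)^* * (e2 * p m - e1)); first by ring.
    rewrite P1 P2; transitivity (-
      ((1 + (q m)^*) * (em step ^+ m.+1 * b m) - (q m)^* * (em step ^+ m * ep step * a m))).
      by rewrite exprS; ring.
    by rewrite -em2; ring.
have em0 : em step != 0.
  by apply/eqP => e0; have := epem step; rewrite e0 mulr0 => /eqP; rewrite eq_sym oner_eq0.
have [E _] := main N (leqnn N).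
have -> : shooting = - em step ^+ N * a N.
  by rewrite -E /p yN mulr0 addr0 /shooting mulrC.
by rewrite mulf_eq0 oppr_eq0 expf_eq0 (negPf em0) andbF.
Qed.

End transfer.

(** * Verblunsky coefficients *)

Local Open Scope sesquilinear_scope.

Section verblunsky.
Context (C : numClosedFieldType) (n : nat).
Variables (V : 'M[C]_n.+1) (e : 'cV[C]_n.+1).
Hypothesis V_unitary : V \is unitarymx.
Local Notation N := n.+1.
Implicit Types (u v : 'cV[C]_n.+1) (p q : {poly C}).

Lemma adjointM m1 m2 m3 (A : 'M[C]_(m1, m2)) (B : 'M[C]_(m2, m3)) :
  (A *m B)^t* = B^t* *m A^t*.
Proof. by rewrite trmx_mul map_mxM. Qed.

Lemma hdotDl u v w : hdot (u + v) w = hdot u w + hdot v w.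
Proof. by rewrite /hdot mulmxDr mxE. Qed.
Lemma hdotZl a u v : hdot (a *: u) v = a * hdot u v.
Proof. by rewrite /hdot -scalemxAr mxE. Qed.
Lemma hdotC u v : hdot u v = (hdot v u)^*.
Proof. by rewrite /hdot -[in LHS](trmxCK u) -adjointM !mxE. Qed.
Lemma hdotDr u v w : hdot w (u + v) = hdot w u + hdot w v.
Proof. by rewrite hdotC hdotDl rmorphD /= -!hdotC. Qed.
Lemma hdotZr a u v : hdot u (a *: v) = a^* * hdot u v.
Proof. by rewrite hdotC hdotZl rmorphM /= -hdotC. Qed.
Lemma hdot0r u : hdot u 0 = 0.
Proof. by rewrite -(scale0r 0) hdotZr rmorph0 mul0r. Qed.

Lemma hdotE u : hdot u u = \sum_i `|u i 0| ^+ 2.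
Proof. by rewrite /hdot mxE; apply: eq_bigr => i _; rewrite !mxE normCK mulrC. Qed.

Lemma hdot_ge0 u : 0 <= hdot u u.
Proof. by rewrite hdotE sumr_ge0// => i _; rewrite exprn_ge0. Qed.

Lemma hdot_eq0 u : hdot u u = 0 -> u = 0.
Proof.
rewrite hdotE => /eqP; rewrite psumr_eq0 => [/allP H|i _]; last by rewrite exprn_ge0.
apply/matrixP => i j; rewrite ord1 mxE; apply/eqP.
by have := H i (mem_index_enum _); rewrite /= sqrf_eq0 normr_eq0.
Qed.

Lemma hdot_adjoint (A : 'M[C]_n.+1) u v : hdot (A *m u) v = hdot u (A^t* *m v).
Proof. by rewrite /hdot adjointM trmxCK mulmxA. Qed.

Lemma unitary_mulmx : V *m V^t* = 1%:M. Proof. exact/unitarymxP. Qed.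
Lemma unitary_mulmxC : V^t* *m V = 1%:M. Proof. exact: mulmx1C unitary_mulmx. Qed.

Lemma hdot_unitary u v : hdot (V *m u) (V *m v) = hdot u v.
Proof. by rewrite hdot_adjoint mulmxA unitary_mulmxC mul1mx. Qed.

Lemma hdot_unitaryX k u v : hdot (V ^+ k *m u) (V ^+ k *m v) = hdot u v.
Proof.
elim: k => [|k IH]; first by rewrite !expr0 !mul1mx.
by rewrite !exprS -!mulmxA hdot_unitary.
Qed.

Lemma horner_mxE p m : (size p <= m)%N -> horner_mx V p = \sum_(i < m) p`_i *: V ^+ i.
Proof.
move=> sp; rewrite {1}(_ : p = \sum_(i < m) p`_i *: 'X^i); last first.
  rewrite -poly_def; apply/polyP => i; rewrite coef_poly.
  by case: ltnP => // /(leq_trans sp) /leq_sizeP ->.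
by rewrite linear_sum; apply: eq_bigr => i _; rewrite linearZ /= rmorphXn /= horner_mx_X.
Qed.

Lemma adjointX k : (V ^+ k)^t* = V^t* ^+ k.
Proof.
elim: k => [|k IH]; first by rewrite !expr0 trmx1 map_mx1.
by rewrite exprS exprSr -!mulmxE adjointM IH.
Qed.

(** For a unitary matrix the inverse is the adjoint, so reversing a polynomial amounts to taking the
    adjoint of its value and multiplying by [V ^+ k]. *)
Lemma horner_mx_dual k p : (size p <= k.+1)%N ->
  horner_mx V (szego_dual k p) = V ^+ k *m (horner_mx V p)^t*.
Proof.
move=> sp; rewrite (horner_mxE sp) (@horner_mxE _ k.+1) ?size_poly//.
have -> : (\sum_(i < k.+1) p`_i *: V ^+ i)^t* = \sum_(i < k.+1) (p`_i)^* *: V^t* ^+ i.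
  rewrite linear_sum raddf_sum /=; apply: eq_bigr => i _.
  by rewrite linearZ /= map_mxZ adjointX.
rewrite mulmx_sumr (reindex_inj rev_ord_inj) /=; apply: eq_bigr => i _.
have ik : (i <= k)%N by rewrite -ltnS.
rewrite subSS coef_poly ltnS leq_subr subKn// -scalemxAr; congr (_ *: _).
have -> : V ^+ k = V ^+ (k - i) *m V ^+ i by rewrite mulmxE -exprD subnK.
rewrite -mulmxA.
suff -> : V ^+ i *m V^t* ^+ i = 1%:M by rewrite mulmx1.
elim: (i : nat) => [|j IH]; first by rewrite !expr0 mulmx1.
by rewrite exprSr exprS -!mulmxE mulmxA -(mulmxA _ V) unitary_mulmx mulmx1.
Qed.

(** [V ^+ k] is an isometry, and [horner_mx V p] is normal, so that it and its adjoint give vectors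
    of equal length. *)
Lemma hdot_horner_dual k p : (size p <= k.+1)%N ->
  hdot (horner_mx V (szego_dual k p) *m e) (horner_mx V (szego_dual k p) *m e) =
  hdot (horner_mx V p *m e) (horner_mx V p *m e).
Proof.
move=> sp; rewrite horner_mx_dual// -mulmxA hdot_unitaryX hdot_adjoint trmxCK.
rewrite [RHS]hdot_adjoint !mulmxA; congr (hdot e (_ *m e)).
have cV : comm_mx V (V^t*) by rewrite /comm_mx unitary_mulmx unitary_mulmxC.
have cp : comm_mx (horner_mx V p) (V^t*) by exact: comm_horner_mx.
suff : comm_mx (horner_mx V p) ((horner_mx V p)^t*) by [].
rewrite {2}(horner_mxE (leqnn _)) linear_sum raddf_sum /=.
apply: comm_mx_sum => i _; rewrite linearZ /= map_mxZ adjointX /comm_mx.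
rewrite -scalemxAr -scalemxAl; congr (_ *: _).
elim: (i : nat) => [|j IH]; first by rewrite expr0 mulmx1 mul1mx.
by rewrite exprS -!mulmxE mulmxA cp -!mulmxA IH.
Qed.

Variables (Phi : nat -> {poly C}) (alpha : nat -> C).
Hypothesis PhiP : orthogonal_polys V e Phi.
Hypothesis szegoP : szego_recursion n.+1 Phi alpha.

Let a k := horner_mx V (Phi k) *m e.

Let Phi_monic k : (k <= n)%N -> Phi k \is monic.
Proof. by case: PhiP => _ H _ _ /H[]. Qed.
Let Phi_size k : (k <= n)%N -> size (Phi k) = k.+1.
Proof. by case: PhiP => _ H _ _ /H[]. Qed.

(** The monic polynomials of lower degree span all polynomials of lower degree. For [k = n] the
    vector itself is zero by Cayley-Hamilton, which lets the norm identity below hold up to the last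
    coefficient. *)
Lemma orthogonal_lower k m q : (k < N)%N -> (m <= k.+1)%N -> (size q <= m)%N ->
  hdot (a k.+1) (horner_mx V q *m e) = 0.
Proof.
move=> kn; have [kn'|nk] := ltnP k n; last first.
  have -> : k = n by apply/eqP; rewrite eqn_leq nk -ltnS kn.
  case: PhiP => _ _ _ E _ _; rewrite /a E.
  by rewrite Cayley_Hamilton mul0mx /hdot mulmx0 mxE.
elim: m q => [|m IH] q mk sq.
  by move: sq; rewrite leqn0 size_poly_eq0 => /eqP ->; rewrite rmorph0 mul0mx hdot0r.
have mn : (m <= n)%N by apply: leq_trans kn'; rewrite ltnW.
(* Removing the top coefficient with the help of [Phi m] lowers the size. *)
pose r := q - q`_m *: Phi m.
have sr : (size r <= m)%N.
  apply/leq_sizeP => j; rewrite leq_eqVlt => /predU1P[<-|mj]; rewrite /r coefB coefZ.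
    have /monicP := Phi_monic mn; rewrite lead_coefE Phi_size//= => ->.
    by rewrite mulr1 subrr.
  rewrite !(@nth_default _ 0 _ j) ?mulr0 ?subrr ?(Phi_size mn)//.
  exact: leq_trans sq _.
have -> : q = q`_m *: Phi m + r by rewrite /r addrC subrK.
rewrite linearD /= mulmxDl hdotDr (IH _ (ltnW mk) sr) addr0.
rewrite linearZ /= -scalemxAl hdotZr.
by case: PhiP => _ _ H _; rewrite -/(a m) H ?mulr0//; rewrite mk kn'.
Qed.

(** Pythagoras: the Szegő recursion decomposes [V *m a k] into [a k.+1] and a multiple of the dual
    vector, which has degree at most k in V and is therefore orthogonal to [a k.+1]. Both [V *m a k]
    and the dual vector are as long as [a k]. *)
Lemma verblunsky_norm k : (k < N)%N ->
  hdot (a k.+1) (a k.+1) = (1 - `|alpha k| ^+ 2) * hdot (a k) (a k).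
Proof.
move=> kN; have kn : (k <= n)%N by rewrite -ltnS.
have [S _] := szegoP kN.
set d := horner_mx V (szego_dual k (Phi k)) *m e.
have Va : V *m a k = a k.+1 + (alpha k)^* *: d.
  rewrite {2}/a S linearB /= mulmxBl !rmorphM /= horner_mx_X horner_mx_C -!mulmxE.
  by rewrite mul_scalar_mx -scalemxAl -/d subrK /a mulmxA.
have ortho : hdot (a k.+1) d = 0.
  apply: (@orthogonal_lower _ k.+1) => //; exact: size_poly.
have dd : hdot d d = hdot (a k) (a k) by apply: hdot_horner_dual; rewrite Phi_size.
have := hdot_unitary (a k) (a k).
rewrite Va !(hdotDl, hdotDr, hdotZl, hdotZr) ortho (hdotC d) ortho rmorph0 !mulr0 addr0 add0r dd.
move=> H; rewrite mulrBl mul1r -{1}H normCK conjCK; ring.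
Qed.

Variable lam : 'I_n.+1 -> C.
Hypothesis lam_inj : injective lam.
Hypothesis lam_eigen : forall i, eigenvalue V (lam i).
Hypothesis e_generic : not_orth_eigenvectors V e.

Lemma row_horner_mx (v : 'rV[C]_n.+1) c p : v *m V = c *: v ->
  v *m horner_mx V p = p.[c] *: v.
Proof.
move=> vV; elim/poly_ind: p => [|p d IH].
  by rewrite rmorph0 mulmx0 horner0 scale0r.
rewrite rmorphD rmorphM /= horner_mx_X horner_mx_C -mulmxE mulmxDr mulmxA IH.
by rewrite -scalemxAl vV scalerA mul_mx_scalar -scalerDl !hornerE.
Qed.

(** Multiplied on the left by a row eigenvector for [lam i], the relation gives [p.[lam i]] times a
    nonzero number. A nonzero [p] would have N distinct roots, too many for its size. *)
Lemma cyclic_vector p : (size p <= N)%N -> horner_mx V p *m e = 0 -> p = 0.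
Proof.
move=> sp pe; apply/eqP; apply: contraTT sp => p0; rewrite -ltnNge.
have roots : all (root p) [seq lam i | i <- enum 'I_n.+1].
  apply/allP => _ /mapP[i _ ->].
  have /eigenvalueP[v vV v0] := lam_eigen i.
  have vn0 : v^t* != 0.
    by apply: contraNneq v0 => H; rewrite -(trmxCK v) H trmx0 map_mx0.
  have c0 : lam i != 0.
    apply/eqP => l0; move: vV; rewrite l0 scale0r => vV; move/eqP: v0; apply.
    by rewrite -(mulmx1 v) -unitary_mulmx mulmxA vV mul0mx.
  (* Unitarity turns a row eigenvector into a column eigenvector, the kind to which the genericity
     of [e] applies. *)
  have : V *m v^t* = ((lam i)^*)^-1 *: v^t*.
    have H : v^t* = (lam i)^* *: (V *m v^t*).
      have := congr1 (fun A => V *m A^t*) vV.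
      by rewrite adjointM mulmxA unitary_mulmx mul1mx linearZ /= map_mxZ -scalemxAr.
    rewrite [in RHS]H scalerA mulVf ?scale1r//.
    by rewrite conjC_eq0.
  move=> /(e_generic vn0) ve; have {}ve : (v *m e) 0 0 != 0.
    by apply: contraNneq ve => H; rewrite /hdot -adjointM 2!mxE H rmorph0.
  have := row_horner_mx p vV => /(congr1 (fun A => (A *m e) 0 0)).
  rewrite -mulmxA pe mulmx0 mxE -scalemxAl mxE => /esym/eqP.
  by rewrite mulf_eq0 (negPf ve) orbF.
have := max_poly_roots p0 roots.
by rewrite size_map size_enum_ord; apply; rewrite map_inj_uniq// enum_uniq.
Qed.

Lemma hdot_a_gt0 k : (k <= n)%N -> 0 < hdot (a k) (a k).
Proof.
move=> kn; rewrite lt_neqAle hdot_ge0 andbT eq_sym; apply/eqP => /hdot_eq0 H.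
have := cyclic_vector (_ : (size (Phi k) <= N)%N) H.
rewrite Phi_size// => /(_ kn) p0; have := Phi_size kn.
by rewrite p0 size_poly0.
Qed.

Lemma verblunsky_lt1 k : (k < n)%N -> `|alpha k| < 1.
Proof.
move=> kn; have := verblunsky_norm (ltnW kn); have := hdot_a_gt0 kn.
move=> + H; rewrite H pmulr_lgt0 ?hdot_a_gt0 1?ltnW//.
by rewrite subr_gt0 expr_lt1.
Qed.

(** In the norm identity at n the left side vanishes by Cayley-Hamilton, while [a n] is nonzero. *)
Lemma verblunsky_last : `|alpha n| = 1.
Proof.
have := verblunsky_norm (leqnn N); case: PhiP => _ _ _ E.
rewrite {1 2}/a E Cayley_Hamilton mul0mx hdot0r => /esym/eqP.
rewrite mulf_eq0 (gt_eqF (hdot_a_gt0 (leqnn n))) orbF subr_eq0 eq_sym.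
by rewrite sqrp_eq1// => /eqP.
Qed.

Lemma szego_dual1 k p : (size p <= k.+1)%N -> (szego_dual k p).[1] = (p.[1])^*.
Proof. by move=> sp; rewrite szego_dualE ?oner_eq0// expr1n mul1r rmorph1 invr1. Qed.

(** At the point 1 the dual polynomial takes the conjugate value, so a first zero of [(Phi k).[1]]
    would force a coefficient of modulus 1 before the last one. *)
Lemma Phi1_neq0 k : (k <= n)%N -> (Phi k).[1] != 0.
Proof.
elim: k => [_|k IH kn]; first by case: PhiP => -> *; rewrite hornerC oner_eq0.
have [S _] := szegoP (ltnW kn); rewrite S !hornerE szego_dual1; last by rewrite Phi_size// ltnW.
have P0 := IH (ltnW kn); rewrite subr_eq0; apply/eqP => H.
have := congr1 Num.norm H; rewrite normrM !norm_conjC => /eqP.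
rewrite -{1}[`|_|]mul1r (inj_eq (mulIf _)) ?normr_eq0// => /eqP H1.
by have := verblunsky_lt1 kn; rewrite -H1 ltxx.
Qed.

End verblunsky.

(** * Logarithms of points of the unit circle *)

Section cis_period.
Context (R : realType).
Local Notation Re := (@complex.Re R).
Local Notation Im := (@complex.Im R).

Lemma cis0 : cis 0 = 1 :> R[i].
Proof. by rewrite /cis cos0 sin0. Qed.

Lemma cis_2pi_int (j : int) : cis (2 * pi * j%:~R) = 1 :> R[i].
Proof.
have nat_case (m : nat) : cis (2 * pi * m%:R) = 1 :> R[i].
  elim: m => [|m IH]; first by rewrite mulr0 cis0.
  rewrite -[m.+1]addn1 natrD mulrDr mulr1 cisD IH mul1r mulr_natl /cis cos2pi.
  by rewrite sin2pi.
case: j => m; first by rewrite -pmulrn nat_case.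
have := cisD (2 * pi * m.+1%:R) (2 * pi * (Negz m)%:~R : R).
rewrite nat_case mul1r => <-.
by rewrite NegzE rmorphN /= -mulrDr -pmulrn subrr mulr0 cis0.
Qed.

Lemma cis_eq1 (a : R) : cis a = 1 -> exists j : int, a = 2 * pi * j%:~R.
Proof.
move=> ca; have pi0 : 0 < 2 * pi :> R by rewrite mulr_gt0// pi_gt0.
pose j := Num.floor (a / (2 * pi)); exists j.
have /andP[j1 j2] := floor_itv (a / (2 * pi)).
pose r := a - 2 * pi * j%:~R.
have r0 : 0 <= r.
  by rewrite /r subr_ge0 mulrC -ler_pdivlMr.
have r2 : r < 2 * pi.
  move: j2; rewrite rmorphD /= rmorph1 ltr_pdivrMr// -/j /r => j2; lra.
have cr : cis r = 1.
  by have := cisD r (2 * pi * j%:~R); rewrite /r subrK ca cis_2pi_int mulr1 => <-.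
suff r00 : r = 0 by apply/eqP; rewrite -subr_eq0 -/r r00.
apply/eqP; rewrite eq_le r0 andbT leNgt; apply/negP => r_gt0.
(* For [r] strictly between 0 and 2 pi, half of it has positive sine, contradicting
   [cos r = 1 - 2 sin(r / 2)^2 = 1]. *)
have sr : 0 < sin (r / 2).
  apply: sin_gt0_pi; rewrite divr_gt0//= ltr_pdivrMr// mulrC //.
have := cos_mulr2n (r / 2); rewrite (_ : r / 2 *+ 2 = r); last by rewrite mulr2n -splitr.
have -> : cos r = 1 by have := congr1 Re cr.
have := cos2Dsin2 (r / 2); have : 0 < sin (r / 2) ^+ 2 by rewrite exprn_gt0.
move=> h1 h2; rewrite mulr2n; lra.
Qed.

Lemma cis_mulV (a : R) : cis a * cis (- a) = 1 :> R[i].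
Proof. by rewrite -cisD subrr cis0. Qed.

Lemma cis_eq (a b : R) : cis a = cis b -> exists j : int, a = b + 2 * pi * j%:~R.
Proof.
move=> ab; have [|j jE] := @cis_eq1 (a - b).
  by rewrite cisD ab cis_mulV.
by exists j; rewrite -jE addrC subrK.
Qed.

(** Comparing moduli forces [z] to be real; comparing arguments then gives a progression of step 2
    pi, stretched by the number of steps of the path. *)
Lemma cexp_eq_cis (z : R[i]) (m : nat) (l : R) :
  cexp ((0 +i* 1)%C * z) m.+1%:R^-1 = cis l <->
  exists j : int, z = (m.+1%:R * l + 2 * pi * m.+1%:R * j%:~R)%:C%C.
Proof.
have m0 : m.+1%:R != 0 :> R by rewrite pnatr_eq0.
have E : cexp ((0 +i* 1)%C * z) m.+1%:R^-1 =
    (expR (- Im z / m.+1%:R))%:C%C * cis (Re z / m.+1%:R).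
  by rewrite /cexp ReM ImM /= !mul0r !mul1r sub0r add0r.
rewrite E; split=> [H|[j ->]]; last first.
  rewrite /= oppr0 mul0r expR0 mul1r.
  have -> : (m.+1%:R * l + 2 * pi * m.+1%:R * j%:~R) / m.+1%:R = l + 2 * pi * j%:~R.
    by field.
  by rewrite cisD cis_2pi_int mulr1.
have HR := congr1 Re H; have HI := congr1 Im H.
move: HR HI; rewrite ReM ImM /= !mul0r subr0 addr0.
set x := expR _ => HR HI.
have x1 : x = 1.
  have x0 : 0 < x by exact: expR_gt0.
  have : x ^+ 2 = 1.
    have h1 := cos2Dsin2 (Re z / m.+1%:R); have h2 := cos2Dsin2 l.
    by rewrite -[LHS]mulr1 -{1}h1 mulrDr -!exprMn HR HI.
  by move/eqP; rewrite sqrp_eq1 ?ltW// => /eqP.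
have Im0 : Im z = 0.
  have : - Im z / m.+1%:R = 0 by apply: expR_inj; rewrite -/x x1 expR0.
  by move/eqP; rewrite mulf_eq0 invr_eq0 (negPf m0) orbF oppr_eq0 => /eqP.
have [|j jE] := @cis_eq (Re z / m.+1%:R) l.
  by move: H; rewrite -/x x1 mul1r.
exists j; apply: complexP => //=.
by rewrite -[LHS](divfK m0) jE; ring.
Qed.

End cis_period.

(** * The Cayley transform *)

Section cayley.
Context (R : realType).
Local Notation Re := (@complex.Re R).
Local Notation Im := (@complex.Im R).

Lemma normc_sq (c : R[i]) : `|c| ^+ 2 = (Re c ^+ 2 + Im c ^+ 2)%:C%C.
Proof.
rewrite normCK; case: c => a b /=; apply: complexP; rewrite ?(ReM, ImM) /=; ring.
Qed.

(** The left side is the real part of [(1 + c) / (1 - c)], which is positive inside the unit disc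
    and zero on its boundary. It is the ratio of successive values of [y]. *)
Lemma cayley_Re (c : R[i]) : c != 1 ->
  1 + 2 * Re (c / (1 - c)) =
  (1 - (Re c ^+ 2 + Im c ^+ 2)) / ((1 - Re c) ^+ 2 + Im c ^+ 2) /\
  0 < (1 - Re c) ^+ 2 + Im c ^+ 2.
Proof.
case: c => a b c1; set d := (1 - Re (a +i* b)%C) ^+ 2 + Im (a +i* b)%C ^+ 2.
have d0 : 0 < d.
  rewrite lt_neqAle addr_ge0 ?sqr_ge0// andbT eq_sym.
  rewrite paddr_eq0 ?sqr_ge0// !sqrf_eq0 /= subr_eq0; apply: contra c1.
  by move=> /andP[/eqP <- /eqP ->].
have c1' : 1 - (a +i* b)%C != 0 by rewrite subr_eq0 eq_sym.
have -> : (a +i* b)%C / (1 - (a +i* b)%C) = ((a * (1 - a) - b ^+ 2) / d +i* (b / d))%C.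
  apply: (mulfI c1'); rewrite mulrC divfK//; move: d0; rewrite /d /= => d0.
  by apply: complexP; rewrite ?(ReM, ImM) /=; field; rewrite gt_eqF.
split=> //; move: d0; rewrite /d /= => d0; field; rewrite gt_eqF//.
Qed.

End cayley.

Theorem proposition18 (R : realType) (n : nat)
    (V : 'M[R[i]]_n.+1) (e : 'cV[R[i]]_n.+1)
    (lambda : 'I_n.+1 -> R) (gamma : nat -> R[i]) (x y : nat -> R)
    (V_unitary : V \is unitarymx)
    (V_eigenvalues : forall a : R[i],
       eigenvalue V a <-> exists k, a = cis (lambda k))
    (V_distinct : injective (fun k => cis (lambda k)))
    (V_not1 : forall k, cis (lambda k) != 1)
    (e_unit : hdot e e = 1)
    (e_generic : not_orth_eigenvectors V e)
    (gammaP : deformed_verblunsky V e gamma)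
    (x0 : x 0%N = 0) (y0 : y 0%N = 1)
    (xS : forall k, (k < n.+1)%N ->
       x k.+1 = x k + (- 2 * complex.Im (gamma k / (1 - gamma k))) * y k)
    (yS : forall k, (k < n.+1)%N ->
       y k.+1 = y k * (1 + 2 * complex.Re (gamma k / (1 - gamma k)))) :
  let X := step_path n.+1 x in
  let Y := step_path n.+1 y in
  [/\ forall t : R, 0 <= t < 1 -> 0 < Y t,
      Y 1 = 0
    & Dir_spectrum X Y None (Some (X 1)) =
      [set z : R[i] | exists (k : 'I_n.+1) (j : int),
         z = (n.+1%:R * lambda k + 2 * pi * n.+1%:R * j%:~R)%:C%C]].
Proof.
move=> X Y.
have [Phi [alpha [PhiP szego gammaE]]] := gammaP.
have lam_eig i : eigenvalue V (cis (lambda i)) by apply/V_eigenvalues; exists i.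
have Phi1 k : (k <= n)%N -> (Phi k).[1] != 0.
  exact: (Phi1_neq0 V_unitary PhiP szego V_distinct lam_eig e_generic).
have Phi_size k : (k <= n)%N -> size (Phi k) = k.+1.
  by case: PhiP => _ H _ _ /H[].
(* At index N the value is det(1 - V), nonzero because 1 is not an eigenvalue. *)
have PhiN1 : (Phi n.+1).[1] != 0.
  case: PhiP => _ _ _ ->; rewrite -/(root _ 1) -eigenvalue_root_char.
  apply/negP => /V_eigenvalues[k H]; have := V_not1 k.
  by rewrite -H eqxx.
have Phi1' k : (k <= n.+1)%N -> (Phi k).[1] != 0.
  by rewrite leq_eqVlt => /predU1P[->//|]; exact: Phi1.
have dual1 k : (k <= n)%N -> (szego_dual k (Phi k)).[1] = ((Phi k).[1])^*.
  by move=> kn; rewrite szego_dual1// Phi_size.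
(* The factor between [gamma k] and the conjugate of [alpha k] is a quotient of conjugate numbers,
   hence of modulus 1. *)
have gamma_norm k : (k <= n)%N -> `|gamma k| = `|alpha k|.
  move=> kn; rewrite gammaE// dual1// !normrM normfV !norm_conjC.
  by rewrite divff ?mulr1// normr_eq0 Phi1.
(* The deformation is designed for this: it absorbs the dual polynomial in the Szegő recursion at
   the point 1. *)
have Phi1S k : (k <= n)%N -> (Phi k.+1).[1] = (Phi k).[1] * (1 - gamma k).
  move=> kn; have [-> _] := szego k kn; rewrite !hornerE gammaE//.
  by field; rewrite Phi1.
have gamma1 k : (k <= n)%N -> gamma k != 1.
  move=> kn; apply/eqP => g1; have := Phi1' k.+1 kn.
  by rewrite Phi1S// g1 subrr mulr0 eqxx.
pose q k := gamma k / (1 - gamma k).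
have ypos k : (k <= n)%N -> 0 < y k.
  elim: k => [_|k IH kn]; first by rewrite y0 ltr01.
  have kn' := ltnW kn; rewrite yS// mulr_gt0 ?IH//.
  have [-> d0] := cayley_Re (gamma1 k kn'); rewrite divr_gt0// subr_gt0.
  rewrite -ltcR -normc_sq gamma_norm// expr_lt1//.
  exact: (verblunsky_lt1 V_unitary PhiP szego V_distinct lam_eig e_generic).
have yN : y n.+1 = 0.
  rewrite yS//; have [-> d0] := cayley_Re (gamma1 n (leqnn n)).
  suff -> : complex.Re (gamma n) ^+ 2 + complex.Im (gamma n) ^+ 2 = 1.
    by rewrite subrr mul0r mulr0.
  apply: (@complexI R); rewrite -normc_sq gamma_norm//.
  by rewrite (verblunsky_last V_unitary PhiP szego V_distinct lam_eig e_generic) expr1n.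
have step1 (f : nat -> R) : step_path n.+1 f 1 = f n.+1.
  by rewrite /step_path mulr1 natrK.
split.
- by move=> t t01; apply: ypos; rewrite -ltnS; exact: truncn_lt.
- by rewrite /Y step1.
rewrite /X step1; apply/funext => z; apply/propext.
have zs (k : nat) : (k < n.+1)%N -> 0 < y k by rewrite ltnS; exact: ypos.
have res := in_resolvent_set_shooting x z zs.
pose zeta := cexp ((0 +i* 1)%C * z) n.+1%:R^-1.
pose a k := (Phi k).[zeta] / (Phi k).[1].
pose b k := (szego_dual k (Phi k)).[zeta] / (szego_dual k (Phi k)).[1].
have dual1_neq0 k : (k <= n.+1)%N -> (szego_dual k (Phi k)).[1] != 0.
  move=> kN; rewrite szego_dual1 ?conjC_eq0 ?Phi1'//.
  move: kN; rewrite leq_eqVlt => /predU1P[->|kn]; last by rewrite Phi_size.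
  by case: PhiP => _ _ _ ->; rewrite size_char_poly.
have q1 k : (k <= n)%N -> 1 + q k = (1 - gamma k)^-1.
  move=> kn; rewrite /q; field.
  by rewrite subr_eq0 eq_sym gamma1.
have PhiE k t : (k <= n)%N -> (Phi k.+1).[t] =
    t * (Phi k).[t] - (alpha k)^* * (szego_dual k (Phi k)).[t].
  by move=> kn; have [-> _] := szego k kn; rewrite !hornerE.
have dualE k t : (k <= n)%N -> (szego_dual k.+1 (Phi k.+1)).[t] =
    (szego_dual k (Phi k)).[t] - alpha k * (t * (Phi k).[t]).
  move=> kn; have [_ ->] := szego k kn; rewrite hornerD !hornerM hornerN hornerC hornerX; ring.
have alphaE k : (k <= n)%N ->
    (alpha k)^* = gamma k * (Phi k).[1] / (szego_dual k (Phi k)).[1].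
  move=> kn; rewrite gammaE//; field.
  by rewrite Phi1// dual1_neq0// ltnW.
(* The Szegő recursion divided by [(Phi k.+1).[1] = (Phi k).[1] * (1 - gamma k)]; for the dual
   polynomials the divisor carries the conjugate factor. *)
have aS k : (k < n.+1)%N -> a k.+1 = (1 + q k) * zeta * a k - q k * b k.
  move=> kn; rewrite q1// /a /b /q PhiE// Phi1S// alphaE//.
  have g1 := gamma1 k kn; have P1 := Phi1 k kn; have D1 := dual1_neq0 k (ltnW kn).
  by field; rewrite P1 D1 subr_eq0 eq_sym g1.
have bS k : (k < n.+1)%N -> b k.+1 = (1 + (q k)^*) * b k - (q k)^* * zeta * a k.
  move=> kn; have g1 := gamma1 k kn; have P1 := Phi1 k kn; have D1 := dual1_neq0 k (ltnW kn).
  have -> : 1 + (q k)^* = (1 - (gamma k)^*)^-1.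
    by rewrite -[1 in LHS](rmorph1 (@Num.conj R[i])) -rmorphD /= q1// fmorphV /= rmorphB rmorph1.
  have -> : (q k)^* = (gamma k)^* / (1 - (gamma k)^*).
    by rewrite /q rmorphM /= fmorphV /= rmorphB rmorph1.
  have aE : alpha k = (gamma k)^* * (szego_dual k (Phi k)).[1] / (Phi k).[1].
    rewrite -[LHS]conjCK alphaE// dual1// !(rmorphM, fmorphV) /= conjCK.
    by [].
  have g1' : 1 - (gamma k)^* != 0.
    by rewrite subr_eq0 eq_sym -(rmorph1 (@Num.conj R[i])) (inj_eq (can_inj conjCK)).
  have dualS : (szego_dual k.+1 (Phi k.+1)).[1] =
      (szego_dual k (Phi k)).[1] * (1 - (gamma k)^*).
    by rewrite dualE// aE; field.
  rewrite /a /b dualS dualE// aE; field.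
  by rewrite P1 D1 g1' /=.
have Phi0 : Phi 0 = 1 by case: PhiP.
have a0 : a 0 = 1 by rewrite /a Phi0 !hornerC divr1.
have b0 : b 0 = 1.
  have d0 : szego_dual 0 (Phi 0) = 1.
    by apply/polyP => -[|i]; rewrite coef_poly Phi0 !coef1 ?rmorph1.
  by rewrite /b d0 !hornerC divr1.
have shE := shooting_eq0 zs x0 y0 yN xS yS a0 b0 aS bS.
(* [a n.+1] is the quotient of det(zeta - V) by the nonzero det(1 - V). *)
have rootE : (a n.+1 == 0) = eigenvalue V zeta.
  case: PhiP => _ _ _ E; rewrite eigenvalue_root_char -E /a mulf_eq0 invr_eq0.
  by rewrite (negPf PhiN1) orbF.
have eigE : eigenvalue V zeta <-> exists k (j : int),
    z = (n.+1%:R * lambda k + 2 * pi * n.+1%:R * j%:~R)%:C%C.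
  split=> [/V_eigenvalues[k /cexp_eq_cis[j zE]]|[k [j zE]]]; first by exists k, j.
  by apply/V_eigenvalues; exists k; apply/cexp_eq_cis; exists j.
rewrite /= -eigE -rootE -shE; split=> [nres|/eqP sh0 /res]; last by rewrite sh0 eqxx.
by apply: contra_notT nres => /res.
Qed.
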